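(* Under the proposed online algorithm (described in the context) with parameters $V>0$ and $\delta>0$, all constraints are satisfied with probability 1, i.e. with probability 1 $$\limsup_{N\to\infty}\frac{\sum_{n=0}^{N-1}z_l[n]}{\sum_{n=0}^{N-1}T[n]}\le c_l\qquad\text{for all }l\in\{1,2,\dots,L\}.$$
   Context: **Model.** Frames $n=0,1,2,\dots$. At the start of frame $n$ a random event $\omega[n]$, i.i.d. over frames with values in a compact set $\Omega\subseteq\mathbb R^q$ (distribution unknown to the controller), is observed and an action $\alpha[n]\in\mathcal A$ is chosen. The pair $(\omega[n],\alpha[n])$ induces the penalty $y[n]$, frame length $T[n]$ and resource vector $\mathbf z[n]=(z_1[n],\dots,z_L[n])$: given $\omega[n]=\omega$, $\alpha[n]=\alpha$, the vector $(y[n],T[n],\mathbf z[n])$ is independent of the outcomes of previous frames, with known conditional expectations $\hat y(\omega,\alpha),\hat T(\omega,\alpha),\hat{\mathbf z}(\omega,\alpha)$. $c_1,\dots,c_L\ge0$ are constants, and $K[n]=\sqrt{\sum_{l=1}^L(z_l[n]-c_lT[n])^2}$. All choices are assumed to yield measurable quantities. **Problem.** Minimize $\limsup_{N\to\infty}\frac{\sum_{n=0}^{N-1}y[n]}{\sum_{n=0}^{N-1}T[n]}$ subject to $\limsup_{N\to\infty}\frac{\sum_{n=0}^{N-1}z_l[n]}{\sum_{n=0}^{N-1}T[n]}\le c_l$ for all $l$ and $\alpha[n]\in\mathcal A$, all in the almost sure sense; $\theta^*$ is the optimal value. **Assumptions.** (1) Given any $\omega[n]=\omega$, $\alpha[n]=\alpha$: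 $T[n]\ge1$ with probability 1 and there are constants $\eta,B>0$ with $\mathbb E[e^{\eta|X[n]|}|\omega,\alpha]\le B+1$ for $X\in\{y,K,T\}$. (2) There is a known constant $\theta_{\max}>0$ with $\theta^*\in[0,\theta_{\max})$. (3) For each fixed $\omega\in\Omega$ the set $\{(\hat y(\omega,\alpha),\hat T(\omega,\alpha),\hat{\mathbf z}(\omega,\alpha)):\alpha\in\mathcal A\}$ is compact. (4) A randomized stationary policy chooses $\alpha^*[n]$, after observing $\omega[n]$, according to a conditional distribution that is the same for all $n$; the set $\mathcal R\subseteq\mathbb R^{L+2}$ of all vectors $\mathbb E[(\hat y,\hat T,\hat{\mathbf z})(\omega[0],\alpha^*[0])]$ over such policies is bounded. (5) ($\xi$-slackness) There are $\xi>0$ and a randomized stationary policy $\alpha^{(\xi)}[n]$ with $\mathbb E[\hat z_l(\omega[n],\alpha^{(\xi)}[n])]/\mathbb E[\hat T(\omega[n],\alpha^{(\xi)}[n])]=c_l-\xi$ for all $l$. **Algorithm** (parameters $V>0,\delta>0$). $Q_l[0]=0$, $\theta[0]=0$. At the start of frame $n$, observe $Q_l[n],\theta[n],\omega[n]$ and choose $\alpha[n]\in\mathcal A$ minimizing $V(\hat y(\omega[n],\alpha)-\theta[n]\hat T(\omega[n],\alpha))+\sum_{l=1}^LQ_l[n](\hat z_l(\omega[n],\alpha)-c_l\hat T(\omega[n],\alpha))$ over $\alpha\in\mathcal A$. Then update $$\theta[n+1]=\Big[\tfrac1{(n+1)^\delta}\sum_{i=0}^n\big(y[i]-\theta[i]T[i]+\tfrac1V\sum_{l=1}^LQ_l[i](z_l[i]-c_lT[i])\big)\Big]_0^{\theta_{\max}},$$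 $$Q_l[n+1]=\max\{Q_l[n]+z_l[n]-c_lT[n],0\},$$ where $[x]_0^{\theta_{\max}}=\min\{\max\{x,0\},\theta_{\max}\}$. *)

(* Defs.v *)
From HB Require Import structures.
From mathcomp Require Import all_boot all_order all_algebra.
From mathcomp Require Import all_classical all_reals all_analysis.

Set Implicit Arguments.
Unset Strict Implicit.
Unset Printing Implicit Defensive.

Import Order.TTheory GRing.Theory Num.Theory.
Import numFieldNormedType.Exports.

Local Open Scope classical_set_scope.
Local Open Scope ring_scope.

(* The type 'rV[R]_n equipped with its Borel sigma-algebra. *)
Notation borel_rV R n := (g_sigma_algebraType (@open 'rV[R]_n)).

(* The outcome ((y, T), z) of a frame. *)
Notation outcome R L := (R * R * borel_rV R L)%type.

Definition penalty (R : realType) (L : nat) (x : outcome R L) : R := x.1.1.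

Definition frame_length (R : realType) (L : nat) (x : outcome R L) : R := x.1.2.

Definition resource (R : realType) (L : nat) (x : outcome R L) (l : 'I_L) : R :=
  (x.2 : 'rV[R]_L) ord0 l.

Definition deviation (R : realType) (L : nat) (c : 'I_L -> R) (x : outcome R L)
    : R :=
  Num.sqrt (\sum_(l < L) (resource x l - c l * frame_length x) ^+ 2).

(* [outcome_law n (w, a)] is the conditional law of the outcome of frame n given
   that the event is w and the action is a. It may vary with n: only its mean,
   given by yhat, That and zhat, is the same for all frames. The action set is
   the whole type A. Only the events in [event_set] are meaningful. *)
Record renewal_model (R : realType) (q L : nat) (dA : measure_display)
    (A : measurableType dA) := RenewalModel {
  event_set : set 'rV[R]_q;
  event_law : probability (borel_rV R q) R;
  outcome_law : nat -> R.-pker (borel_rV R q * A)%type ~> outcome R L;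
  yhat : 'rV[R]_q -> A -> R;
  That : 'rV[R]_q -> A -> R;
  zhat : 'rV[R]_q -> A -> 'rV[R]_L;
  budget : 'I_L -> R
}.

Definition well_formed (R : realType) (q L : nat) (dA : measure_display)
    (A : measurableType dA) (M : renewal_model R q L A) : Prop :=
  [/\ compact (event_set M),
      event_law M (event_set M) = 1%E,
      (forall l, 0 <= budget M l) &
      forall n w a, event_set M w ->
        [/\ (\int[outcome_law M n (w, a)]_x (penalty x)%:E)%E
              = (yhat M w a)%:E,
            (\int[outcome_law M n (w, a)]_x (frame_length x)%:E)%E
              = (That M w a)%:E &
            forall l, (\int[outcome_law M n (w, a)]_x (resource x l)%:E)%E
              = (zhat M w a ord0 l)%:E]].

Definition exponential_type (R : realType) (q L : nat) (dA : measure_display)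
    (A : measurableType dA) (M : renewal_model R q L A) : Prop :=
  (forall n w a, event_set M w ->
     {ae outcome_law M n (w, a), forall x, 1 <= frame_length x}) /\
  (exists eta B : R, 0 < eta /\ 0 < B /\
     forall n w a, event_set M w ->
       let expmoment (X : outcome R L -> R) : \bar R :=
         (\int[outcome_law M n (w, a)]_x (expR (eta * `|X x|))%:E)%E in
       [/\ (expmoment (@penalty R L) <= (B + 1)%:E)%E,
           (expmoment (deviation (budget M)) <= (B + 1)%:E)%E &
           (expmoment (@frame_length R L) <= (B + 1)%:E)%E]).

Definition compact_options (R : realType) (q L : nat) (dA : measure_display)
    (A : measurableType dA) (M : renewal_model R q L A) : Prop :=
  forall w, event_set M w ->
    compact [set (yhat M w a, That M w a, zhat M w a) | a in [set: A]].

(* Processes on a sample space S: a realization of all the frames. *)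
Record process (R : realType) (q L : nat) (dA : measure_display)
    (A : measurableType dA) (dS : measure_display) (S : measurableType dS) :=
    Process {
  event_of : nat -> S -> borel_rV R q;
  action_of : nat -> S -> A;
  outcome_of : nat -> S -> outcome R L
}.

(* The sigma-algebra generated by the events, actions and outcomes of the
   frames before n. *)
Definition past (R : realType) (q L : nat) (dA : measure_display)
    (A : measurableType dA) (dS : measure_display) (S : measurableType dS)
    (X : process R q L A S) (n : nat) : set (set S) :=
  <<s \bigcup_(i in [set i | (i < n)%N])
        (preimage_set_system [set: S] (event_of X i) measurable `|`
         preimage_set_system [set: S] (action_of X i) measurable `|`
         preimage_set_system [set: S] (outcome_of X i) measurable) >>.

(* X is governed by M under some causal, possibly randomized and
   history-dependent, choice of actions. The event of frame n has law
   [event_law M] and is independent of the past, hence the events are i.i.d.;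
   the outcome of frame n has conditional law [outcome_law M n (w, a)] given its
   event w, its action a and the past. Nothing constrains how the action of
   frame n depends on the past, on the event of frame n and on external
   randomness. *)
Definition driven_by (R : realType) (q L : nat) (dA : measure_display)
    (A : measurableType dA) (M : renewal_model R q L A)
    (dS : measure_display) (S : measurableType dS) (P : probability S R)
    (X : process R q L A S) : Prop :=
  let pair n (s : S) := (event_of X n s, action_of X n s) in
  [/\ (forall n s, event_set M (event_of X n s)),
      (forall n, [/\ measurable_fun [set: S] (event_of X n),
                     measurable_fun [set: S] (action_of X n) &
                     measurable_fun [set: S] (outcome_of X n)]),
      (forall n H D, past X n H -> measurable D ->
         P (H `&` event_of X n @^-1` D) = (P H * event_law M D)%E) &
      (forall n H C D, past X n H -> measurable C -> measurable D ->
         P (H `&` pair n @^-1` C `&` outcome_of X n @^-1` D)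
         = (\int[P]_(s in H `&` pair n @^-1` C)
              outcome_law M n (pair n s) D)%E)].

Definition average_penalty (R : realType) (q L : nat) (dA : measure_display)
    (A : measurableType dA) (dS : measure_display) (S : measurableType dS)
    (X : process R q L A S) (s : S) (N : nat) : R :=
  (\sum_(0 <= n < N) penalty (outcome_of X n s)) /
  (\sum_(0 <= n < N) frame_length (outcome_of X n s)).

Definition average_resource (R : realType) (q L : nat) (dA : measure_display)
    (A : measurableType dA) (dS : measure_display) (S : measurableType dS)
    (X : process R q L A S) (l : 'I_L) (s : S) (N : nat) : R :=
  (\sum_(0 <= n < N) resource (outcome_of X n s) l) /
  (\sum_(0 <= n < N) frame_length (outcome_of X n s)).

Definition satisfies_constraints (R : realType) (q L : nat)
    (dA : measure_display) (A : measurableType dA) (M : renewal_model R q L A)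
    (dS : measure_display) (S : measurableType dS) (P : probability S R)
    (X : process R q L A S) : Prop :=
  {ae P, forall s, forall l,
     (limn_esup (fun N => (average_resource X l s N)%:E)
        <= (budget M l)%:E)%E}.

(* The infimum of the levels that the limsup of the average penalty can be kept
   below almost surely, over all causal policies on all probability spaces that
   satisfy the constraints almost surely. *)
Definition optimal_value (R : realType) (q L : nat) (dA : measure_display)
    (A : measurableType dA) (M : renewal_model R q L A) : \bar R :=
  ereal_inf [set theta : \bar R |
    exists (dS : measure_display) (S : measurableType dS)
           (P : probability S R) (X : process R q L A S),
      [/\ driven_by M P X, satisfies_constraints M P X &
          {ae P, forall s,
             (limn_esup (fun N => (average_penalty X s N)%:E) <= theta)%E}]].

(* Expectation of g (w, a) when w follows the event law and, given w, a is
   drawn from [pi w]. *)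
Definition stationary_mean (R : realType) (q L : nat) (dA : measure_display)
    (A : measurableType dA) (M : renewal_model R q L A)
    (pi : R.-pker borel_rV R q ~> A) (g : 'rV[R]_q -> A -> R) : \bar R :=
  (\int[event_law M]_(w in event_set M) \int[pi w]_a (g w a)%:E)%E.

Definition stationary_performance (R : realType) (q L : nat)
    (dA : measure_display) (A : measurableType dA) (M : renewal_model R q L A)
    (pi : R.-pker borel_rV R q ~> A) (v : R * R * 'rV[R]_L) : Prop :=
  [/\ stationary_mean M pi (yhat M) = (v.1.1)%:E,
      stationary_mean M pi (That M) = (v.1.2)%:E &
      forall l, stationary_mean M pi (fun w a => zhat M w a ord0 l)
                = (v.2 ord0 l)%:E].

Definition stationary_region (R : realType) (q L : nat) (dA : measure_display)
    (A : measurableType dA) (M : renewal_model R q L A) :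
    set (R * R * 'rV[R]_L) :=
  [set v | exists pi : R.-pker borel_rV R q ~> A, stationary_performance M pi v].

Definition slackness (R : realType) (q L : nat) (dA : measure_display)
    (A : measurableType dA) (M : renewal_model R q L A) : Prop :=
  exists (xi : R) (pi : R.-pker borel_rV R q ~> A) (v : R * R * 'rV[R]_L),
    [/\ 0 < xi, stationary_performance M pi v &
        forall l, v.2 ord0 l / v.1.2 = budget M l - xi].

(* The quantity minimized over a, for multipliers Q and th. *)
Definition objective (R : realType) (q L : nat) (dA : measure_display)
    (A : measurableType dA) (M : renewal_model R q L A) (V : R)
    (Q : 'I_L -> R) (th : R) (w : 'rV[R]_q) (a : A) : R :=
  V * (yhat M w a - th * That M w a)
  + \sum_(l < L) Q l * (zhat M w a ord0 l - budget M l * That M w a).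

Definition online_algorithm (R : realType) (q L : nat) (dA : measure_display)
    (A : measurableType dA) (M : renewal_model R q L A) (V delta theta_max : R)
    (dS : measure_display) (S : measurableType dS) (X : process R q L A S)
    (Q : nat -> S -> 'I_L -> R) (theta : nat -> S -> R) : Prop :=
  forall s : S,
  let y n := penalty (outcome_of X n s) in
  let T n := frame_length (outcome_of X n s) in
  let z n l := resource (outcome_of X n s) l in
  [/\ (forall l, Q 0%N s l = 0),
      theta 0%N s = 0,
      (forall n a, objective M V (Q n s) (theta n s)
                     (event_of X n s) (action_of X n s)
                   <= objective M V (Q n s) (theta n s) (event_of X n s) a),
      (forall n, theta n.+1 s =
         Num.min (Num.max
           ((n.+1%:R `^ delta)^-1 *
            \sum_(0 <= i < n.+1)
              (y i - theta i s * T i +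
               V^-1 * \sum_(l < L) Q i s l * (z i l - budget M l * T i)))
           0) theta_max) &
      (forall n l, Q n.+1 s l =
         Num.max (Q n s l + z n l - budget M l * T n) 0)].

(* Main.v *)
Require Import Defs.
From mathcomp Require Import all_boot all_order all_algebra.
From mathcomp Require Import all_classical all_reals all_analysis.
From mathcomp Require Import finmap measurable_realfun lra ring zify.

Import Order.TTheory GRing.Theory Num.Theory.
Import numFieldNormedType.Exports.

Local Open Scope classical_set_scope.
Local Open Scope ring_scope.

(** Write [x_l n] for [z_l[n] - c_l T[n]]. The queue recursion gives
    [sum_(n < N) x_l n <= Q_l[N]], and [T[n] >= 1] almost surely, so it is enough
    that [Q_l[N] / N] tends to 0 almost surely. Comparing the chosen action with
    the slack stationary policy, and using that [theta[n]] is clipped to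
    [[0, theta_max]], the conditional drift [sum_l Q_l[n] E(x_l n | past)] is
    bounded by a constant; with uniformly bounded second moments of [x_l n] this
    yields [E Q_l[n]^2 <= K n]. Along the squares [n = k^2] this makes
    [E (Q_l[n] / n)^2] summable, and Cauchy-Schwarz controls the growth of the
    queue between [k^2] and [(k + 1)^2]. *)

(** * Conditional expectations of products *)

(** The model supplies conditional laws tested on events of the past, and [yhat], [That], [zhat] are
    bare functions. The drift is therefore computed through one product formula: if [f] is known
    from the past and [Y] has law [k s] given the past, then [f * h(Y)] and [f] times the
    [k s]-integral of [h] have the same mean. It is used twice, with [f] a queue. With [outcome_law]
    it replaces x_l n by its mean given event and action; with the constant kernel [event_law] it
    gives E(Q H) = E(Q) E(H) <= 0, where H is the mean excess of the slack policy at the current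
    event. Between the two stands a pointwise inequality, since the algorithm minimizes at each
    event separately; the slack policy is never run on [S]. The formula presupposes a finite mean of
    the queue, so integrability and the linear bound go through one induction. Squares are taken
    because E (Q_l[n] / n)^2 <= K / n is not summable over all n, while at n = k^2 it is of order 1
    / k^2; a block has 2k + 1 frames, so the growth inside it has mean square of order k^2, to be
    divided by k^4. *)

Section ge0_measurable_induction.
Import HBNNSimple.

(** Monotone class principle for nonnegative functions. It serves two sigma-algebras below: the one
    of the target space of [Y], and the one that [C] generates on [S]. *)
Lemma ge0_measurable_ind d (T : measurableType d) (R : realType)
    (Phi : (T -> \bar R) -> Prop) :
  (forall A, measurable A -> Phi (EFin \o \1_A)) ->
  (forall (r : R) (f : T -> \bar R), 0 <= r -> measurable_fun [set: T] f ->
     (forall x, 0 <= f x)%E -> Phi f -> Phi (fun x => r%:E * f x)%E) ->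
  (forall f g : T -> \bar R,
     measurable_fun [set: T] f -> measurable_fun [set: T] g ->
     (forall x, 0 <= f x)%E -> (forall x, 0 <= g x)%E ->
     Phi f -> Phi g -> Phi (fun x => f x + g x)%E) ->
  (forall (f : (T -> \bar R)^nat) g,
     (forall n, measurable_fun [set: T] (f n)) -> (forall n x, 0 <= f n x)%E ->
     (forall x, {homo f ^~ x : m n / (m <= n)%N >-> (m <= n)%E}) ->
     (forall x, f n x @[n --> \oo] --> g x) ->
     (forall n, Phi (f n)) -> Phi g) ->
  forall f : T -> \bar R, measurable_fun [set: T] f -> (forall x, 0 <= f x)%E ->
  Phi f.
Proof.
move=> Phi1 PhiZ PhiD Philim f mf f0.
pose g := nnsfun_approx measurableT mf.
apply: (Philim (fun n => EFin \o g n)).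
- by move=> n; exact/measurable_EFinP.
- by move=> n x; rewrite lee_fin.
- by move=> x m n mn; rewrite lee_fin; exact/lefP/nd_nnsfun_approx.
- by move=> x; exact: cvg_nnsfun_approx.
move=> n; move: (g n) => {}g.
(* A simple function is the finite sum of its values times the indicators of its fibres; the list of
   values is generalized to allow induction on it. The empty sum is the indicator of [set0]. *)
have Phisum (s : seq R) : {in s, forall r, 0 <= r} ->
    Phi (fun x => (\sum_(r <- s) r * \1_(g @^-1` [set r]) x)%:E).
  elim: s => [|r s IH] s0.
    under eq_fun do rewrite big_nil.
    have /(Phi1 _) : measurable (@set0 T) by [].
    by congr Phi; apply/funext => x; rewrite /= indic0.
  under eq_fun do rewrite big_cons EFinD.
  have ms (t : seq R) : measurable_fun [set: T]
      (fun x => (\sum_(r <- t) r * \1_(g @^-1` [set r]) x)%:E).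
    apply: measurableT_comp; first exact: EFin_measurable.
    by apply: measurable_sum => y; exact: measurable_funM.
  have s0' : {in s, forall r, 0 <= r} by move=> y ys; apply: s0; rewrite in_cons ys orbT.
  have mr : measurable_fun [set: T] (EFin \o (\1_(g @^-1` [set r]) : T -> R)).
    by apply/measurable_EFinP; exact: measurable_indic.
  apply: PhiD => //.
  - by under eq_fun do rewrite EFinM; exact: measurable_funeM.
  - by move=> x; rewrite lee_fin mulr_ge0// s0// mem_head.
  - move=> x; rewrite lee_fin big_seq sumr_ge0// => y ys.
    by rewrite mulr_ge0// s0'.
  - under eq_fun do rewrite EFinM.
    apply: PhiZ => //; first by rewrite s0// mem_head.
    exact: Phi1.
  - exact: IH.
rewrite (_ : EFin \o g =
    fun x => (\sum_(r <- fset_set (range g)) r * \1_(g @^-1` [set r]) x)%:E).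
  apply: Phisum => r; rewrite in_fset_set// => /set_mem[x _ <-]; exact: fun_ge0.
by apply/funext => x /=; rewrite {1}fimfunE fsbig_finite.
Qed.

End ge0_measurable_induction.

Section conditional_law.
Local Set Implicit Arguments.
Local Unset Strict Implicit.
Context d d2 (S : measurableType d) (T : measurableType d2) (R : realType).
Variables (P : {measure set S -> \bar R}) (C : set (set S)) (Y : S -> T).
(** [k] is measurable on [S] but need not be measurable for [C]: it will be the law of an outcome
    given the current event and action, which the past does not determine. [Pk] tests it on sets of
    [<<s C >>] only, which is enough for factors measurable with respect to [C]. *)
Variable k : S -> {measure set T -> \bar R}.
Hypothesis C_measurable : <<s C >> `<=` @measurable _ S.
Hypothesis mY : measurable_fun [set: S] Y.
Hypothesis mk : forall D, measurable D -> measurable_fun [set: S] (k ^~ D).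
Hypothesis Pk : forall H D, <<s C >> H -> measurable D ->
  P (H `&` Y @^-1` D) = (\int[P]_(s in H) k s D)%E.

Lemma cvg_integral_nondecreasing d' (U : measurableType d')
    (mu : {measure set U -> \bar R}) (D : set U) (f : (U -> \bar R)^nat)
    (g : U -> \bar R) :
  measurable D -> (forall n, measurable_fun D (f n)) ->
  (forall n x, 0 <= f n x)%E ->
  (forall x, {homo f ^~ x : m n / (m <= n)%N >-> (m <= n)%E}) ->
  (forall x, f n x @[n --> \oo] --> g x) ->
  (\int[mu]_(x in D) f n x)%E @[n --> \oo] --> (\int[mu]_(x in D) g x)%E.
Proof.
move=> mD mf f0 ndf fg.
rewrite (_ : g = fun x => limn (f ^~ x)).
  by apply: cvg_monotone_convergence => // x _ m n; exact: ndf.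
by apply/funext => x; apply/esym/cvg_lim.
Qed.

Lemma measurable_integral_law (h : T -> \bar R) : measurable_fun [set: T] h ->
  (forall y, 0 <= h y)%E ->
  measurable_fun [set: S] (fun s => \int[k s]_y h y)%E.
Proof. by move=> mh h0; exact: measurable_fun_integral_kernel. Qed.

(** [Pk] is the case of indicators, and both sides are additive and continuous along nondecreasing
    limits in [h]. *)
Lemma integral_conditional_law H (h : T -> \bar R) : <<s C >> H ->
  measurable_fun [set: T] h -> (forall y, 0 <= h y)%E ->
  (\int[P]_(s in H) h (Y s) = \int[P]_(s in H) \int[k s]_y h y)%E.
Proof.
move=> CH; have mH : measurable H by exact: C_measurable.
have mhY (f : T -> \bar R) : measurable_fun [set: T] f ->
    measurable_fun H (fun s => f (Y s)).
  by move=> mf; apply: measurable_funTS; exact: measurableT_comp.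
have mint (f : T -> \bar R) : measurable_fun [set: T] f ->
    (forall y, 0 <= f y)%E -> measurable_fun H (fun s => \int[k s]_y f y)%E.
  by move=> mf f0; apply: measurable_funTS; exact: measurable_integral_law.
move: h; apply: ge0_measurable_ind.
- move=> A mA; under [RHS]eq_integral do rewrite integral_indic// setIT.
  by rewrite -Pk// setIC -integral_indic// -[Y @^-1` A]setTI; exact: mY.
- move=> r f r0 mf f0 IH; rewrite ge0_integralZl_EFin//; last exact: mhY.
  under [RHS]eq_integral do rewrite ge0_integralZl_EFin//.
  rewrite ge0_integralZl_EFin//; first by rewrite IH.
    by move=> s _; exact: integral_ge0.
  exact: mint.
- move=> f g mf mg f0 g0 IHf IHg.
  rewrite ge0_integralD//; [|exact: mhY..].
  under [RHS]eq_integral do rewrite ge0_integralD//.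
  rewrite ge0_integralD//; first by rewrite IHf IHg.
  + by move=> s _; exact: integral_ge0.
  + exact: mint.
  + by move=> s _; exact: integral_ge0.
  + exact: mint.
- move=> f g mf f0 ndf fg IH.
  have : (\int[P]_(s in H) f n (Y s))%E @[n --> \oo] --> (\int[P]_(s in H) g (Y s))%E.
    by apply: cvg_integral_nondecreasing => // n; exact: mhY.
  under eq_fun do rewrite IH.
  move/cvg_lim => <-//; apply/cvg_lim => //.
  apply: cvg_integral_nondecreasing => //.
  + by move=> n; exact: mint.
  + by move=> n s; exact: integral_ge0.
  + move=> s m n mn; apply: ge0_le_integral => // y _; exact: ndf.
  + by move=> s; exact: cvg_integral_nondecreasing.
Qed.

(** Induction on [f], over the sigma-algebra generated by [C]: for the indicator of [A] the claim is
    [integral_conditional_law] with [H := A]. Finiteness of [h] and of its integrals allows a limit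
    in [f] to be multiplied by a fixed factor. *)
Lemma ge0_integral_conditional_lawM (f : S -> \bar R) (h : T -> \bar R) :
  measurable_fun [set: g_sigma_algebraType C] f -> (forall s, 0 <= f s)%E ->
  measurable_fun [set: T] h -> (forall y, 0 <= h y)%E ->
  (forall y, h y \is a fin_num) -> (forall s, \int[k s]_y h y \is a fin_num)%E ->
  (\int[P]_s (f s * h (Y s)) = \int[P]_s (f s * \int[k s]_y h y))%E.
Proof.
move=> + + mh h0 hfin intfin.
have subC (g : S -> \bar R) :
    measurable_fun [set: g_sigma_algebraType C] g -> measurable_fun [set: S] g.
  by move=> mg _ B mB; apply: C_measurable; exact: mg.
have mhY : measurable_fun [set: S] (fun s => h (Y s)) by exact: measurableT_comp.
have mint := measurable_integral_law mh h0.
have int0 s : (0 <= \int[k s]_y h y)%E by exact: integral_ge0.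
move: f; apply: (@ge0_measurable_ind _ (g_sigma_algebraType C) R) => /=.
- move=> A CA.
  have mA : d.-measurable (A : set S) by exact: C_measurable.
  have indicE (g : S -> \bar R) :
      (\int[P]_s ((\1_A s)%:E * g s) = \int[P]_(s in A) g s)%E.
    rewrite [RHS]integral_mkcond; apply: eq_integral => s _ /=.
    by rewrite patchE indicE; case: (s \in A); rewrite ?mul1e ?mul0e.
  by rewrite !indicE; exact: integral_conditional_law.
- move=> r f r0 mf f0 IH.
  under eq_integral do rewrite -muleA.
  under [RHS]eq_integral do rewrite -muleA.
  rewrite !ge0_integralZl_EFin ?IH//; try by move=> s _; exact: mule_ge0.
  + by apply: emeasurable_funM => //; exact: subC.
  + by apply: emeasurable_funM => //; exact: subC.
- move=> f g mf mg f0 g0 IHf IHg.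
  under eq_integral do rewrite ge0_muleDl//.
  under [RHS]eq_integral do rewrite ge0_muleDl//.
  by rewrite !ge0_integralD ?IHf ?IHg//;
    try (by move=> s _; exact: mule_ge0);
    apply: emeasurable_funM => //; exact: subC.
- move=> f g mf f0 ndf fg IH.
  have cv (u : S -> \bar R) : measurable_fun [set: S] u -> (forall s, 0 <= u s)%E ->
      (forall s, u s \is a fin_num) ->
      (\int[P]_s (f n s * u s))%E @[n --> \oo] --> (\int[P]_s (g s * u s))%E.
    move=> mu u0 ufin; apply: cvg_integral_nondecreasing => //.
    + by move=> n; apply: emeasurable_funM => //; exact: subC.
    + by move=> n s; exact: mule_ge0.
    + by move=> s m n mn; apply: lee_wpmul2r => //; exact: ndf.
    + by move=> s; apply: cvgeZr => //; exact: fg.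
  have := cv _ mhY (fun s => h0 (Y s)) (fun s => hfin (Y s)).
  under eq_fun do rewrite IH.
  by move/cvg_lim => <-//; apply/cvg_lim => //; exact: cv.
Qed.

(** The signed [h] is split into its positive and negative parts. The uniform bound [c] makes each
    conditional product at most [c * f], hence integrable, so the two identities may be
    subtracted. *)
Lemma integral_conditional_lawM (f : S -> R) (h : T -> R) (c : R) :
  measurable_fun [set: g_sigma_algebraType C] f -> (forall s, 0 <= f s) ->
  P.-integrable [set: S] (EFin \o f) -> measurable_fun [set: T] h ->
  (forall s, \int[k s]_y `|h y|%:E <= c%:E)%E ->
  [/\ P.-integrable [set: S] (fun s => (f s * h (Y s))%:E),
      P.-integrable [set: S] (fun s => (f s)%:E * \int[k s]_y (h y)%:E)%E &
      (\int[P]_s (f s * h (Y s))%:E =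
       \int[P]_s ((f s)%:E * \int[k s]_y (h y)%:E))%E].
Proof.
move=> mf f0 intf mh hc.
have mfE : measurable_fun [set: g_sigma_algebraType C] (EFin \o f) by exact/measurable_EFinP.
have mfS : measurable_fun [set: S] (EFin \o f).
  by move=> _ B mB; apply: C_measurable; exact: mfE.
have mabs : measurable_fun [set: T] (fun y => `|h y|%:E).
  by apply/measurable_EFinP; exact: measurableT_comp.
(* Used for both parts of [h], and for the absolute value of [h] to get integrability of the
   product. *)
have bounded (u : T -> \bar R) : measurable_fun [set: T] u ->
    (forall y, 0 <= u y <= `|h y|%:E)%E ->
  [/\ forall s, (\int[k s]_y u y \is a fin_num)%E,
      P.-integrable [set: S] (fun s => (f s)%:E * \int[k s]_y u y)%E &
      (\int[P]_s ((f s)%:E * u (Y s)) = \int[P]_s ((f s)%:E * \int[k s]_y u y))%E].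
  move=> mu ub; have u0 y : (0 <= u y)%E by case/andP: (ub y).
  have uh y : (u y <= `|h y|%:E)%E by case/andP: (ub y).
  have uc s : (\int[k s]_y u y <= c%:E)%E.
    by apply: le_trans (hc s); exact: ge0_le_integral.
  have int0 s : (0 <= \int[k s]_y u y)%E by exact: integral_ge0.
  have fin s : (\int[k s]_y u y \is a fin_num)%E.
    by rewrite ge0_fin_numE// (le_lt_trans (uc s))// ltry.
  split => //.
    apply: (@le_integrable _ _ _ _ _ measurableT _ (fun s => c%:E * (f s)%:E)%E).
    - by apply: emeasurable_funM => //; exact: measurable_integral_law.
    - move=> s _; rewrite !abseM muleC; apply: lee_pmul => //.
      by rewrite gee0_abs// (le_trans (uc s))// lee_abs.
    - exact: integrableZl.
  apply: (@ge0_integral_conditional_lawM (EFin \o f)) => //.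
  by move=> y; rewrite ge0_fin_numE// (le_lt_trans (uh y))// ltry.
have [||p1 p2 p3] := bounded (EFin \o h)^\+%E.
- by apply: measurable_funepos; exact/measurable_EFinP.
- move=> y; rewrite funepos_ge0/= !funeposE /= -EFin_max lee_fin ge_max.
  by rewrite ler_norm normr_ge0.
have [||n1 n2 n3] := bounded (EFin \o h)^\-%E.
- by apply: measurable_funeneg; exact/measurable_EFinP.
- move=> y; rewrite funeneg_ge0/= !funenegE /= -?EFinN -EFin_max lee_fin ge_max.
  by rewrite -normrN ler_norm normrN normr_ge0.
have posE : (fun s => (f s * h (Y s))%:E)^\+%E =
    (fun s => (f s)%:E * (EFin \o h)^\+ (Y s))%E.
  apply/funext => s; rewrite !funeposE /= -!EFin_max -EFinM.
  by rewrite maxr_pMr// mulr0.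
have negE : (fun s => (f s * h (Y s))%:E)^\-%E =
    (fun s => (f s)%:E * (EFin \o h)^\- (Y s))%E.
  apply/funext => s; rewrite !funenegE /= -?EFinN -!EFin_max -EFinM.
  by rewrite maxr_pMr// mulr0 mulrN.
have mfh : measurable_fun [set: S] (fun s => (f s * h (Y s))%:E).
  apply/measurable_EFinP; apply: measurable_funM; first exact/measurable_EFinP.
  exact: measurableT_comp.
split.
  apply/integrableP; split => //.
  have [||_ /integrableP[_] + eqn] := bounded (fun y => `|h y|%:E) => //.
    by move=> y; rewrite lee_fin normr_ge0 lexx.
  apply: le_lt_trans.
  under [leLHS]eq_integral do rewrite /= normrM EFinM (ger0_norm (f0 _)).
  rewrite eqn; apply: ge0_le_integral => //.
  - by move=> s _; rewrite mule_ge0 ?lee_fin//; exact: integral_ge0.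
  - apply: emeasurable_funM => //; exact: measurable_integral_law.
  - apply: measurableT_comp => //.
    apply: emeasurable_funM => //; exact: measurable_integral_law.
  - by move=> s _; exact: lee_abs.
  have := integrableB measurableT p2 n2.
  apply: eq_integrable => // s _ /=; rewrite -muleBr ?fin_num_adde_defl// -?integralE//.
  by rewrite fin_numN.
rewrite integralE posE negE p3 n3 -integralB//.
apply: eq_integral => s _ /=; rewrite -muleBr ?fin_num_adde_defl// -?integralE//.
by rewrite fin_numN.
Qed.
End conditional_law.

(** * Almost sure sublinear growth *)

(** Telescoping: 1 / x^2 <= 2 / x - 2 / (x + 1) as soon as x >= 1. *)
Lemma sum_inv_sqr_le (R : realFieldType) n :
  \sum_(0 <= k < n) (k.+1%:R ^+ 2)^-1 <= 2 - 2 / n.+1%:R :> R.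
Proof.
elim: n => [|n IH]; first by rewrite big_nil divr1 subrr.
rewrite big_nat_recr//=; apply: (le_trans (lerD IH (lexx _))).
have -> : n.+2%:R = n.+1%:R + 1 :> R by rewrite -natr1.
have : 1 <= n.+1%:R :> R by rewrite ler1n.
move: (n.+1%:R) => x x1.
rewrite -subr_ge0 (_ : _ - _ = (x - 1) / (x ^+ 2 * (x + 1))).
  by rewrite divr_ge0 ?subr_ge0// mulr_ge0// ?sqr_ge0//; lra.
by field; apply/andP; split; lra.
Qed.

(** Cauchy-Schwarz against the constant sequence 1; in the induction the cross terms are absorbed by
    2ab <= a^2 + b^2. *)
Lemma sqr_sum_le (R : realFieldType) (a : nat -> R) m :
  (\sum_(0 <= i < m) a i) ^+ 2 <= m%:R * \sum_(0 <= i < m) a i ^+ 2.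
Proof.
elim: m => [|m IH]; first by rewrite big_nil expr0n mul0r.
rewrite !big_nat_recr//=.
set s := \sum_(0 <= i < m) a i; set t := \sum_(0 <= i < m) _ ^+ 2.
have : 2 * s * a m <= t + m%:R * a m ^+ 2.
  have -> : m%:R * a m ^+ 2 = \sum_(0 <= i < m) a m ^+ 2.
    by rewrite sumr_const_nat subn0 mulr_natl.
  rewrite {}/s {}/t -mulrA mulr_suml mulr_sumr -big_split/=.
  by apply: ler_sum => i _; have := sqr_ge0 (a i - a m); rewrite sqrrB; lra.
by move: IH; rewrite -/s -/t -natr1 sqrrD; lra.
Qed.

Lemma square_block n : exists2 k, (k ^ 2 <= n)%N & (n < k.+1 ^ 2)%N.
Proof.
elim: n => [|n [k kn nk]]; first by exists 0%N.
have [h|h] := ltnP n.+1 (k.+1 ^ 2); first by exists k; lia.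
by exists k.+1 => //; apply: (leq_ltn_trans nk); rewrite ltn_sqr.
Qed.

(** The right-hand side depends on the block and not on [n], so one random variable controls the
    whole block. [(2 * k).+1] is the block length, and the outer 2 comes from (a + b)^2 <= 2 (a^2 +
    b^2). *)
Lemma block_growth (R : realFieldType) (q x : nat -> R) k n :
  (forall n, 0 <= q n) -> (forall n, q n.+1 <= q n + `|x n|) ->
  (k ^ 2 <= n < k.+1 ^ 2)%N ->
  q n ^+ 2 <= 2 * (q (k ^ 2)%N ^+ 2 +
    (2 * k).+1%:R * \sum_(0 <= i < (2 * k).+1) x (k ^ 2 + i)%N ^+ 2).
Proof.
move=> q0 qx /andP[kn nk].
have step j : q (k ^ 2 + j)%N <= q (k ^ 2)%N + \sum_(0 <= i < j) `|x (k ^ 2 + i)%N|.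
  elim: j => [|j IH]; first by rewrite addn0 big_nil addr0.
  by rewrite addnS big_nat_recr//= addrA (le_trans (qx _))// lerD2r.
have := step (n - k ^ 2)%N; rewrite subnKC// => qn.
set m := (2 * k).+1.
have mono : \sum_(0 <= i < n - k ^ 2) `|x (k ^ 2 + i)%N| <=
    \sum_(0 <= i < m) `|x (k ^ 2 + i)%N|.
  have nm : (n - k ^ 2 <= m)%N by move: nk; rewrite /m -!mulnn; lia.
  by rewrite [leRHS](big_cat_nat _ nm)//= lerDl sumr_ge0.
have := sqr_sum_le _ (fun i => `|x (k ^ 2 + i)%N|) m.
under [X in _ <= _ * X]eq_bigr do rewrite real_normK ?num_real//.
move: mono qn (q0 n) (q0 (k ^ 2)%N).
set s := \sum_(0 <= i < m) `|_|; move: (\sum_(0 <= i < m) _ ^+ 2) => t.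
move: (\sum_(0 <= i < _) _) (q n) (q (k ^ 2)%N) => r qn qk rs qr qn0 qk0 st.
have : qn ^+ 2 <= (qk + s) ^+ 2 by rewrite ler_sqr ?nnegrE; lra.
by move/le_trans; apply; have := sqr_ge0 (qk - s); rewrite sqrrB sqrrD; lra.
Qed.

Section almost_sure_growth.
Local Set Implicit Arguments.
Context d (S : measurableType d) (R : realType) (P : {measure set S -> \bar R}).

(** The sum of all [u k] has a finite integral, hence is finite almost everywhere, and there its
    terms tend to 0. *)
Lemma ae_cvg0_summable_mean (u : nat -> S -> R) (c : R) :
  (forall k, measurable_fun [set: S] (u k)) -> (forall k s, 0 <= u k s) ->
  (forall k, \int[P]_s (u k s)%:E <= (c / k.+1%:R ^+ 2)%:E)%E ->
  {ae P, forall s, u ^~ s @ \oo --> 0}.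
Proof.
move=> mu u0 uc.
have c0 : 0 <= c.
  have : (0 <= \int[P]_s (u 0%N s)%:E)%E by apply: integral_ge0 => s _; rewrite lee_fin.
  by move=> h; have := le_trans h (uc 0%N); rewrite lee_fin expr1n divr1.
have muE k : measurable_fun [set: S] (EFin \o u k) by exact/measurable_EFinP.
pose U s := (\sum_(0 <= k <oo) (u k s)%:E)%E.
have U0 s : (0 <= U s)%E by apply: nneseries_ge0 => k _ _; rewrite lee_fin.
have mU : measurable_fun [set: S] U.
  have := @ge0_emeasurable_sum _ _ _ [set: S] (fun k s => (u k s)%:E) xpredT.
  by apply; [move=> k s _ _; rewrite lee_fin|move=> k _; exact: muE].
have intU : P.-integrable [set: S] U.
  apply/integrableP; split => //.
  under eq_integral do rewrite gee0_abs//.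
  rewrite integral_nneseries//; last by move=> k s _; rewrite lee_fin.
  apply: (@le_lt_trans _ _ (c * 2)%:E); last by rewrite ltry.
  apply: lime_le.
    by apply: is_cvg_nneseries => k _ _; apply: integral_ge0 => s _; rewrite lee_fin.
  apply: nearW => n.
  apply: (@le_trans _ _ (\sum_(0 <= k < n) (c / k.+1%:R ^+ 2))%:E).
    by rewrite -sumEFin; apply: lee_sum => k _; exact: uc.
  rewrite lee_fin -mulr_sumr ler_wpM2l// (le_trans (sum_inv_sqr_le _ n))//.
  by rewrite lerBlDr lerDl divr_ge0.
have /= := integrable_ae measurableT intU.
apply: filterS => s /(_ Logic.I) Us.
have uE0 k : (0 <= (u k s)%:E)%E by rewrite lee_fin.
have Uy : (U s < +oo)%E by rewrite -ge0_fin_numE.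
have /fine_cvgP[_] := nneseries_tail_cvg Uy (fun k _ => uE0 k).
apply: (@squeeze_cvgr _ _ _ _ (cst 0)); last exact: cvg_cst.
near=> n; rewrite u0/=.
have tailn : (\sum_(n <= k <oo) (u k s)%:E <= U s)%E.
  rewrite /U (nneseries_split 0 n); last by move=> k _; rewrite lee_fin.
  by rewrite add0n leeDr// sume_ge0// => k _; rewrite lee_fin.
rewrite -lee_fin fineK; last first.
  rewrite ge0_fin_numE ?(le_lt_trans tailn)//.
  by apply: nneseries_ge0 => k _ _; rewrite lee_fin.
have := @nneseries_lim_ge R (fun k => (u k s)%:E) xpredT n n.+1.
by rewrite big_nat1; apply => k _ _; rewrite lee_fin.
Unshelve. all: by end_near. Qed.

Lemma ae_cvg0_div (q x : nat -> S -> R) (c : R) :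
  (forall n, measurable_fun [set: S] (q n)) ->
  (forall n, measurable_fun [set: S] (x n)) ->
  (forall n s, 0 <= q n s) -> (forall n s, q n.+1 s <= q n s + `|x n s|) ->
  (forall n, \int[P]_s (q n s ^+ 2)%:E <= (c * n%:R)%:E)%E ->
  (forall n, \int[P]_s (x n s ^+ 2)%:E <= c%:E)%E ->
  {ae P, forall s, (fun n => q n s / n%:R) @ \oo --> 0}.
Proof.
move=> mq mx q0 qx qc xc.
pose W k s := q (k ^ 2)%N s ^+ 2 +
  (2 * k).+1%:R * \sum_(0 <= i < (2 * k).+1) x (k ^ 2 + i)%N s ^+ 2.
(* Normalizing by k + 1 instead of k keeps the block [k = 0] meaningful. *)
pose u k s := (k.+1%:R ^+ 4)^-1 * W k s.
have mx2 n : measurable_fun [set: S] (fun s => x n s ^+ 2) by exact: measurable_funX.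
have mq2 n : measurable_fun [set: S] (fun s => q n s ^+ 2) by exact: measurable_funX.
have msum k : measurable_fun [set: S]
    (fun s => \sum_(0 <= i < (2 * k).+1) x (k ^ 2 + i)%N s ^+ 2).
  exact: measurable_sum.
have mW k : measurable_fun [set: S] (W k).
  by apply: measurable_funD => //; exact: measurable_funM.
have W0 k s : 0 <= W k s.
  by rewrite addr_ge0 ?sqr_ge0// mulr_ge0// sumr_ge0// => i _; rewrite sqr_ge0.
have c0 : 0 <= c.
  have h : (0 <= \int[P]_s (x 0%N s ^+ 2)%:E)%E.
    by apply: integral_ge0 => s _; rewrite lee_fin sqr_ge0.
  by have := le_trans h (xc 0%N); rewrite lee_fin.
(* 5 = 1 + 4: the queue at k^2 contributes c k^2, and the increments c (2k + 1)^2 <= 4 c (k +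
   1)^2. *)
have Wc k : (\int[P]_s (W k s)%:E <= (5 * c * k.+1%:R ^+ 2)%:E)%E.
  under eq_integral do rewrite EFinD [X in (_ + X)%E]EFinM.
  rewrite ge0_integralD//=; last 4 first.
  - by move=> s _; rewrite lee_fin sqr_ge0.
  - exact/measurable_EFinP.
  - by move=> s _; rewrite mule_ge0// lee_fin sumr_ge0// => i _; rewrite sqr_ge0.
  - by apply: measurable_funeM; exact/measurable_EFinP.
  rewrite ge0_integralZl_EFin//; last 2 first.
  - by move=> s _; rewrite lee_fin sumr_ge0// => i _; rewrite sqr_ge0.
  - exact/measurable_EFinP.
  under [X in (_ + _ * X)%E]eq_integral do rewrite -sumEFin.
  rewrite ge0_integral_sum//; last 2 first.
  - by move=> i; exact/measurable_EFinP.
  - by move=> i s _; rewrite lee_fin sqr_ge0.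
  have h : (\sum_(0 <= i < (2 * k).+1) \int[P]_s (x (k ^ 2 + i)%N s ^+ 2)%:E
      <= (c * (2 * k).+1%:R)%:E)%E.
    apply: (le_trans (lee_sum _ (fun i _ => xc _))).
    by rewrite sumEFin sumr_const_nat subn0 mulr_natr.
  apply: (le_trans (leeD (qc _) (lee_wpmul2l _ h))); first by rewrite lee_fin.
  rewrite -EFinM -EFinD lee_fin natrX -[_.+1%:R]natr1 natrM -[k.+1%:R]natr1.
  by have : 0 <= k%:R :> R by []; nra.
have uc k : (\int[P]_s (u k s)%:E <= (5 * c / k.+1%:R ^+ 2)%:E)%E.
  under eq_integral do rewrite EFinM.
  rewrite ge0_integralZl_EFin ?invr_ge0//;
    [|by move=> s _; rewrite lee_fin|exact/measurable_EFinP].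
  apply: (le_trans (lee_wpmul2l _ (Wc k))); first by rewrite lee_fin invr_ge0 exprn_ge0.
  rewrite -EFinM lee_fin le_eqVlt; apply/orP; left; apply/eqP.
  by field; rewrite gt_eqF.
have u0 k s : 0 <= u k s by rewrite mulr_ge0// invr_ge0.
have mu k : measurable_fun [set: S] (u k) by exact: measurable_funM.
have := ae_cvg0_summable_mean _ _ mu u0 uc.
apply: filterS => s us.
apply/cvgr0Pnorm_lt => e e0.
(* 32 = 2 * 16: the factor 2 of [block_growth], and 16 from (k + 1)^4 <= 16 n^2. *)
have e32 : 0 < e ^+ 2 / 32 by rewrite divr_gt0// exprn_gt0.
have /cvgr0Pnorm_lt/(_ _ e32)[K _ uK] := us.
(* n > K^2 forces K <= k and also k >= 1, which is what gives k + 1 <= 2k. *)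
exists (K ^ 2).+1 => // n /= Kn.
have [k kn nk] := square_block n.
have Kk : (K <= k)%N.
  by rewrite -ltnS -ltn_sqr (leq_ltn_trans _ nk)// ltnW.
have k0 : (0 < k)%N by move: nk Kn; case: (k) => //; rewrite exp1n; case: (n).
have n0 : 0 < n%:R :> R by rewrite ltr0n (leq_trans _ kn)// expn_gt0 k0.
rewrite normf_div (ger0_norm (q0 n s)) gtr0_norm// ltr_pdivrMr//.
rewrite -ltr_sqr ?nnegrE//; last by rewrite mulr_ge0// ltW.
have nkb : (k ^ 2 <= n < k.+1 ^ 2)%N by rewrite kn.
have := block_growth _ (q ^~ s) (x ^~ s) k n (q0 ^~ s) (qx ^~ s) nkb.
move/le_lt_trans; apply.
have -> : q (k ^ 2)%N s ^+ 2 +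
  (2 * k).+1%:R * \sum_(0 <= i < (2 * k).+1) x (k ^ 2 + i)%N s ^+ 2 =
  k.+1%:R ^+ 4 * u k s.
  by rewrite /u mulVKf// expf_neq0.
have uke : u k s < e ^+ 2 / 32 by have := uK k Kk; rewrite ger0_norm.
have k4n : k.+1%:R ^+ 2 <= 4 * n%:R :> R.
  rewrite -natrX -natrM ler_nat; apply: (@leq_trans (4 * k ^ 2)).
    by rewrite (_ : 4 = 2 ^ 2)%N// -expnMn leq_sqr; lia.
  by rewrite leq_mul2l.
have k16 : k.+1%:R ^+ 4 <= 16 * n%:R ^+ 2 :> R.
  rewrite (_ : _ ^+ 4 = (k.+1%:R ^+ 2) ^+ 2); last by rewrite -exprM.
  have : 0 <= k.+1%:R ^+ 2 :> R by rewrite exprn_ge0.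
  nra.
have n2 : 0 < n%:R ^+ 2 :> R by rewrite exprn_gt0.
have := u0 k s.
rewrite exprMn; nra.
Qed.

End almost_sure_growth.

(** * Moments of an outcome *)

Lemma measurable_coord (R : realType) n (i : 'I_n) :
  measurable_fun [set: borel_rV R n] (fun v : borel_rV R n => (v : 'rV[R]_n) ord0 i).
Proof.
apply: (measurability _ (RGenOpens.measurableE R)) => _ [_ [x [y ->]] <-].
rewrite setTI; apply: sub_sigma_algebra.
apply: open_comp; last exact: interval_open.
by move=> v _; exact: coord_continuous.
Qed.

Lemma compact_measurable_rV (R : realType) n (E : set 'rV[R]_n) :
  compact E -> measurable (E : set (borel_rV R n)).
Proof.
move=> /(compact_closed (@norm_hausdorff _ _))/closed_openC oE.
by rewrite -[E]setCK; apply: measurableC; exact: sub_sigma_algebra.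
Qed.

Section moments.
Local Set Implicit Arguments.
Context d (T : measurableType d) (R : realType) (mu : {measure set T -> \bar R}).

(** With t = eta |X|, both bounds come from the exponential series: t <= e^t and t^2 / 2 <= e^t. *)
Lemma exponential_moment_bounds (X : T -> R) (eta b : R) :
  measurable_fun [set: T] X -> 0 < eta ->
  (\int[mu]_x (expR (eta * `|X x|))%:E <= b%:E)%E ->
  (\int[mu]_x `|X x|%:E <= (eta^-1 * b)%:E)%E /\
  (\int[mu]_x (X x ^+ 2)%:E <= (2 * eta ^- 2 * b)%:E)%E.
Proof.
move=> mX eta0 Xb.
have mN : measurable_fun [set: T] (fun x => `|X x|) by exact: measurableT_comp.
have mexp : measurable_fun [set: T] (fun x => expR (eta * `|X x|)).
  by apply: measurableT_comp; [exact: measurable_expR|exact: measurable_funM].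
have key (c : R) (f : T -> R) : measurable_fun [set: T] f -> 0 <= c ->
    (forall x, 0 <= f x <= c * expR (eta * `|X x|)) ->
    (\int[mu]_x (f x)%:E <= (c * b)%:E)%E.
  move=> mf c0 fc.
  apply: (@le_trans _ _ (\int[mu]_x (c%:E * (expR (eta * `|X x|))%:E))%E).
    apply: ge0_le_integral => //.
    - by move=> x _; rewrite lee_fin; case/andP: (fc x).
    - exact/measurable_EFinP.
    - by apply/measurable_funeM; exact/measurable_EFinP.
    - by move=> x _; rewrite -EFinM lee_fin; case/andP: (fc x).
  rewrite ge0_integralZl_EFin//; last exact/measurable_EFinP.
  by rewrite EFinM lee_wpmul2l// lee_fin.
have ez x : 0 <= eta * `|X x| by rewrite mulr_ge0// ltW.
split; apply: key => //.
- by rewrite invr_ge0 ltW.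
- move=> x; rewrite normr_ge0 mulrC ler_pdivlMr// mulrC.
  have := expR_ge1Dxn 0 (ez x); rewrite expr1 divr1; lra.
- exact: measurable_funX.
- by rewrite mulr_ge0// invr_ge0 exprn_ge0// ltW.
- move=> x; rewrite sqr_ge0/= -mulrA mulrCA mulrC ler_pdivlMr ?exprn_gt0//.
  have := expR_ge1Dxn 1 (ez x); rewrite exprMn real_normK ?num_real// !factS fact0; lra.
Qed.

End moments.

Section model.
Local Set Implicit Arguments.
Context (R : realType) (q L : nat) (dA : measure_display) (A : measurableType dA).
Variable M : renewal_model R q L A.

Definition excess (l : 'I_L) (x : outcome R L) : R :=
  resource x l - budget M l * frame_length x.

Lemma measurable_penalty : measurable_fun [set: outcome R L] (@penalty R L).
Proof. exact: (measurableT_comp measurable_fst measurable_fst). Qed.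

Lemma measurable_frame_length : measurable_fun [set: outcome R L] (@frame_length R L).
Proof. exact: (measurableT_comp measurable_snd measurable_fst). Qed.

Lemma measurable_resource l :
  measurable_fun [set: outcome R L] (fun x => resource x l).
Proof. exact: (measurableT_comp (@measurable_coord R L l) measurable_snd). Qed.

Lemma measurable_excess l : measurable_fun [set: outcome R L] (excess l).
Proof.
apply: measurable_funB; first exact: measurable_resource.
by apply: measurable_funM => //; exact: measurable_frame_length.
Qed.

Lemma measurable_deviation :
  measurable_fun [set: outcome R L] (deviation (budget M)).
Proof.
apply: measurableT_comp; first exact: continuous_measurable_fun (@sqrt_continuous R).
apply: measurable_sum => l; apply: measurable_funX; exact: measurable_excess.
Qed.

Lemma sqr_excess_le l x : excess l x ^+ 2 <= deviation (budget M) x ^+ 2.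
Proof.
rewrite sqr_sqrtr; last by apply: sumr_ge0 => j _; exact: sqr_ge0.
by rewrite (bigD1 l)//= lerDl sumr_ge0// => j _; exact: sqr_ge0.
Qed.

Lemma norm_excess_le l x : `|excess l x| <= `|deviation (budget M) x|.
Proof. by rewrite -ler_sqr ?nnegrE// !real_normK ?num_real ?sqr_excess_le. Qed.

(** The excess is one coordinate of the vector whose norm is [deviation], and the resource is the
    excess plus the budget times the frame length. *)
Lemma uniform_moments : exponential_type M -> exists2 C : R, 0 <= C &
  forall n w a, event_set M w ->
  [/\ (\int[outcome_law M n (w, a)]_x `|penalty x|%:E <= C%:E)%E,
      (\int[outcome_law M n (w, a)]_x `|frame_length x|%:E <= C%:E)%E,
      (forall l, \int[outcome_law M n (w, a)]_x `|excess l x|%:E <= C%:E)%E,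
      (forall l, \int[outcome_law M n (w, a)]_x (excess l x ^+ 2)%:E <= C%:E)%E &
      (forall l, \int[outcome_law M n (w, a)]_x `|resource x l|%:E <= C%:E)%E].
Proof.
move=> [_ [eta [B [eta0 [B0 hB]]]]].
pose c1 := eta^-1 * (B + 1); pose c2 := 2 * eta ^- 2 * (B + 1).
pose c := \sum_(l < L) `|budget M l|.
have c10 : 0 <= c1 by rewrite mulr_ge0 ?invr_ge0 ?addr_ge0// ltW.
have c20 : 0 <= c2 by rewrite !mulr_ge0 ?invr_ge0 ?exprn_ge0 ?addr_ge0// ltW.
have c0 : 0 <= c by apply: sumr_ge0.
(* [c1] bounds first moments, [c2] second moments, and [c1 * c] pays for the budget times the frame
   length inside the resource. *)
exists (c1 + c2 + c1 * c); first by rewrite !addr_ge0// mulr_ge0.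
move=> n w a Ew; set mu := outcome_law M n (w, a).
have [hy hK hT] := hB n w a Ew.
have [y1 _] := exponential_moment_bounds _ _ _ measurable_penalty eta0 hy.
have [T1 _] := exponential_moment_bounds _ _ _ measurable_frame_length eta0 hT.
have [K1 K2] := exponential_moment_bounds _ _ _ measurable_deviation eta0 hK.
rewrite -/c1 in y1 T1 K1; rewrite -/c2 in K2.
have cc : 0 <= c1 * c by rewrite mulr_ge0.
have mabs (f : outcome R L -> R) : measurable_fun [set: outcome R L] f ->
    measurable_fun [set: outcome R L] (fun x => `|f x|%:E).
  by move=> mf; apply/measurable_EFinP; exact: measurableT_comp.
have D1 l : (\int[mu]_x `|excess l x|%:E <= c1%:E)%E.
  apply: (le_trans _ K1); apply: ge0_le_integral => //.
  - apply: mabs; exact: measurable_excess.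
  - apply: mabs; exact: measurable_deviation.
  - by move=> x _; rewrite lee_fin norm_excess_le.
split.
- by apply: (le_trans y1); rewrite lee_fin; lra.
- by apply: (le_trans T1); rewrite lee_fin; lra.
- by move=> l; apply: (le_trans (D1 l)); rewrite lee_fin; lra.
- move=> l; apply: (@le_trans _ _ c2%:E); last by rewrite lee_fin; lra.
  apply: (le_trans _ K2); apply: ge0_le_integral => //.
  + by move=> x _; rewrite lee_fin sqr_ge0.
  + by apply/measurable_EFinP; apply: measurable_funX; exact: measurable_excess.
  + by apply/measurable_EFinP; apply: measurable_funX; exact: measurable_deviation.
  + by move=> x _; rewrite lee_fin sqr_excess_le.
- move=> l; apply: (@le_trans _ _
    (\int[mu]_x (`|excess l x|%:E + `|budget M l|%:E * `|frame_length x|%:E))%E).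
    apply: ge0_le_integral => //.
    + apply: mabs; exact: measurable_resource.
    + apply: emeasurable_funD; first by apply: mabs; exact: measurable_excess.
      by apply: measurable_funeM; apply: mabs; exact: measurable_frame_length.
    + move=> x _; rewrite -EFinM -EFinD lee_fin -normrM.
      by rewrite {1}(_ : resource x l = excess l x + budget M l * frame_length x)
        ?ler_normD// /excess subrK.
  rewrite ge0_integralD//; last 2 first.
  + by apply: mabs; exact: measurable_excess.
  + by apply: measurable_funeM; apply: mabs; exact: measurable_frame_length.
  rewrite ge0_integralZl_EFin//; last by apply: mabs; exact: measurable_frame_length.
  apply: (le_trans (leeD (D1 l) (lee_wpmul2l _ T1))); first by rewrite lee_fin.
  rewrite -EFinM -EFinD lee_fin.
  have : `|budget M l| * c1 <= c1 * c.
    by rewrite mulrC ler_wpM2l// /c (bigD1 l)//= lerDl sumr_ge0.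
  lra.
Qed.

End model.

(** * Comparison with the slack stationary policy *)

Section integrals.
Local Set Implicit Arguments.
Local Unset Strict Implicit.
Context d (T : measurableType d) (R : realType) (mu : {measure set T -> \bar R}).

Lemma integrable_norm_le (f : T -> R) (c : R) : measurable_fun [set: T] f ->
  (\int[mu]_x `|f x|%:E <= c%:E)%E -> mu.-integrable [set: T] (EFin \o f).
Proof.
move=> mf fc; apply/integrableP; split; first exact/measurable_EFinP.
by under eq_integral do rewrite /= ; rewrite (le_lt_trans fc)// ltry.
Qed.

Lemma norm_mean_le (f : T -> R) (m c : R) : measurable_fun [set: T] f ->
  (\int[mu]_x `|f x|%:E <= c%:E)%E -> (\int[mu]_x (f x)%:E = m%:E)%E -> `|m| <= c.
Proof.
move=> mf fc fm; rewrite -lee_fin; apply: (le_trans _ fc).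
rewrite -abse_EFin -fm; apply: le_abse_integral => //; exact/measurable_EFinP.
Qed.

(** With a negative [c] this serves for sums too; naming the values [a] and [b] keeps later
    arithmetic in [R]. *)
Lemma integral_subZ (f g : T -> R) (c a b : R) :
  mu.-integrable [set: T] (fun x => (f x)%:E) ->
  mu.-integrable [set: T] (fun x => (g x)%:E) ->
  (\int[mu]_x (f x)%:E = a%:E)%E -> (\int[mu]_x (g x)%:E = b%:E)%E ->
  mu.-integrable [set: T] (fun x => (f x - c * g x)%:E) /\
  (\int[mu]_x (f x - c * g x)%:E = (a - c * b)%:E)%E.
Proof.
move=> fi gi fa gb; have cgi := integrableZl measurableT c gi.
split.
  have := integrableB measurableT fi cgi.
  by apply: eq_integrable => // x _; rewrite /= EFinB EFinM.
under eq_integral do rewrite EFinB EFinM.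
by rewrite integralB//= integralZl// fa gb -EFinM.
Qed.

Lemma integral_lincomb (I : finType) (c m : I -> R) (f : I -> T -> R) :
  (forall i, mu.-integrable [set: T] (fun x => (f i x)%:E)) ->
  (forall i, \int[mu]_x (f i x)%:E = (m i)%:E)%E ->
  mu.-integrable [set: T] (fun x => (\sum_i c i * f i x)%:E) /\
  (\int[mu]_x (\sum_i c i * f i x)%:E = (\sum_i c i * m i)%:E)%E.
Proof.
move=> fi fm; have cfi i := integrableZl measurableT (c i) (fi i).
have sE x : (\sum_i c i * f i x)%:E = (\sum_i (c i)%:E * (f i x)%:E)%E.
  by rewrite -sumEFin; under eq_bigr do rewrite EFinM.
split.
  have := integrable_sum measurableT (index_enum I) (fun i (_ : xpredT i) => cfi i).
  by apply: eq_integrable => // x _; rewrite sE.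
under eq_integral do rewrite sE.
rewrite (integral_sum measurableT cfi).
rewrite -sumEFin; apply: eq_bigr => i _.
by rewrite integralZl// fm EFinM.
Qed.

End integrals.

Lemma integral_probability_cst d (T : measurableType d) (R : realType)
    (mu : probability T R) (c : R) : (\int[mu]_x c%:E = c%:E)%E.
Proof.
by rewrite integral_cst// -[RHS]mule1; congr (_ * _)%E; exact: probability_setT.
Qed.

Lemma measurable_integral_pkernel d d' (X : measurableType d) (Y : measurableType d')
    (R : realType) (k : R.-pker X ~> Y) (f : X * Y -> R) :
  measurable_fun [set: X * Y] f ->
  measurable_fun [set: X] (fun x => \int[k x]_y (f (x, y))%:E)%E.
Proof.
move=> mf; have mfE : measurable_fun [set: X * Y] (EFin \o f) by exact/measurable_EFinP.
under eq_fun do rewrite integralE.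
apply: emeasurable_funB.
- have := @measurable_fun_integral_finite_kernel _ _ _ _ _ (EFin \o f)^\+%E k.
  move=> /(_ (fun z => funepos_ge0 _ z) (measurable_funepos mfE)).
  apply: eq_measurable_fun => x _; apply: eq_integral => y _.
  by rewrite !funeposE.
- have := @measurable_fun_integral_finite_kernel _ _ _ _ _ (EFin \o f)^\-%E k.
  move=> /(_ (fun z => funeneg_ge0 _ z) (measurable_funeneg mfE)).
  apply: eq_measurable_fun => x _; apply: eq_integral => y _.
  by rewrite !funenegE.
Qed.

Section stationary.
Local Set Implicit Arguments.
Local Unset Strict Implicit.
Context (R : realType) (q L : nat) (dA : measure_display) (A : measurableType dA).
Variable M : renewal_model R q L A.

Lemma mean_frame_length_ge1 w a : well_formed M -> exponential_type M ->
  event_set M w -> 1 <= That M w a.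
Proof.
move=> [_ _ _ hmean] [hT _] Ew; rewrite -lee_fin.
have [_ <- _] := hmean 0%N w a Ew.
set mu := outcome_law M 0 (w, a).
have mu1 : mu setT = 1%E by exact: prob_kernel.
have mT := @measurable_frame_length R L.
(* The frame length is at least 1 only almost surely; its maximum with 1 has the same integral and
   is at least 1 everywhere. *)
have mTm : measurable_fun [set: outcome R L] (fun x => Num.max (frame_length x) 1).
  exact: measurable_maxr.
rewrite (ae_eq_integral (fun x => (Num.max (frame_length x) 1)%:E))//.
- rewrite (_ : 1%E = \int[mu]_x (cst 1%E x))%E; last first.
    by rewrite integral_cst// mul1e mu1.
  apply: ge0_le_integral => //.
  + exact/measurable_EFinP.
  + by move=> x _; rewrite lee_fin le_max lexx orbT.
- exact/measurable_EFinP.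
- exact/measurable_EFinP.
- have := hT 0%N w a Ew; apply: filterS => x Tx _.
  by congr EFin; rewrite max_l.
Qed.

(** [g] will be [That] or a coordinate of [zhat]. Its measurability is inherited from the kernel
    integral of [h], with which it agrees on the event set. [G w] is the mean of [g w] under
    [pi w]. *)
Lemma stationary_average (g : 'rV[R]_q -> A -> R) (h : outcome R L -> R) (C : R)
    (pi : R.-pker borel_rV R q ~> A) :
  compact (event_set M) -> measurable_fun [set: outcome R L] h -> 0 <= C ->
  (forall w a, event_set M w ->
     (\int[outcome_law M 0 (w, a)]_x (h x)%:E = (g w a)%:E)%E /\
     (\int[outcome_law M 0 (w, a)]_x `|h x|%:E <= C%:E)%E) ->
  exists G : borel_rV R q -> R,
  [/\ measurable_fun [set: borel_rV R q] G, (forall w, `|G w| <= C),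
      (forall w, event_set M w ->
         (pi w).-integrable [set: A] (fun a => (g w a)%:E) /\
         (\int[pi w]_a (g w a)%:E = (G w)%:E)%E) &
      (stationary_mean M pi g = \int[event_law M]_w (G w)%:E)%E].
Proof.
move=> /compact_measurable_rV mE mh C0 hg.
pose k := outcome_law M 0.
pose E2 : set (borel_rV R q * A) := event_set M `*` setT.
have mE2 : measurable E2 by exact: measurableX.
(* Set to 0 off the event set, where the moments of [h] are not controlled, so that [C] bounds [gE]
   everywhere. The event set is measurable because it is compact, hence closed. *)
pose gE := (fun p => fine (\int[k p]_x (h x)%:E)%E) \_ E2.
have mgE : measurable_fun [set: borel_rV R q * A] gE.
  apply/(measurable_restrictT _ mE2); apply: measurable_funTS.
  apply: measurableT_comp; first exact: fine_measurable.
  apply: (@measurable_integral_pkernel _ _ _ _ _ k (fun p => h p.2)).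
  exact: measurableT_comp.
have gEE w a : event_set M w -> gE (w, a) = g w a.
  move=> Ew; rewrite /gE patchE mem_set//.
  by have [-> _] := hg w a Ew.
have gEC p : `|gE p| <= C.
  rewrite /gE patchE; case: ifPn => [|_]; last by rewrite normr0.
  case: p => w a /set_mem[/= Ew _].
  have [gw hC] := hg w a Ew; rewrite gw.
  exact: norm_mean_le hC gw.
pose I w := (\int[pi w]_a (gE (w, a))%:E)%E.
have mI : measurable_fun [set: borel_rV R q] I by exact: measurable_integral_pkernel.
have mgEw w : measurable_fun [set: A] (fun a => gE (w, a)).
  exact: measurableT_comp (pair1_measurable w).
have absC w : (\int[pi w]_a `|gE (w, a)|%:E <= C%:E)%E.
  apply: (@le_trans _ _ (\int[pi w]_a (cst C%:E a))%E).
    apply: ge0_le_integral => //.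
    + by apply/measurable_EFinP; apply: measurableT_comp => //; exact: mgEw.
    + by move=> a _; rewrite lee_fin.
  by rewrite integral_cst// prob_kernel mule1.
have intgE w : (pi w).-integrable [set: A] (EFin \o (fun a => gE (w, a))).
  exact: integrable_norm_le (mgEw w) (absC w).
have Ifin w : I w \is a fin_num by exact: integrable_fin_num.
have IE w : I w = (fine (I w))%:E by rewrite fineK.
exists (fun w => fine (I w)); split.
- exact: measurableT_comp.
- by move=> w; exact: norm_mean_le (mgEw w) (absC w) (IE w).
- move=> w Ew; split.
    apply: eq_integrable (intgE w) => // a _ /=; by rewrite gEE.
  by rewrite -IE; apply: eq_integral => a _; rewrite gEE.
- rewrite /stationary_mean integral_mkcond; apply: eq_integral => w _.
  rewrite -IE patchE; case: ifPn => [/set_mem Ew|nEw].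
    by apply: eq_integral => a _; rewrite gEE.
  rewrite /I integral0_eq// => a _; rewrite /gE patchE ifN//.
  by apply: contra nEw => /set_mem[Ew _]; exact: mem_set.
Qed.

Lemma excess_mean n w a l : well_formed M -> exponential_type M -> event_set M w ->
  (\int[outcome_law M n (w, a)]_x (excess M l x)%:E =
   (zhat M w a ord0 l - budget M l * That M w a)%:E)%E.
Proof.
move=> [_ _ _ hmean] hexp Ew; have [C C0 mom] := uniform_moments hexp.
have [_ mT _ _ mz] := mom n w a Ew; have [_ hT hz] := hmean n w a Ew.
have iz := integrable_norm_le (@measurable_resource R L l) (mz l).
have iT := integrable_norm_le (@measurable_frame_length R L) mT.
by have [_ ->] := integral_subZ (budget M l) iz iT (hz l) hT.
Qed.

(** [H l w] is the mean excess of the slack policy at the event [w]. The chosen action does at least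
    as well as each action [b] at [w]; averaging over [b] drawn from [pi w] compares it with the
    slack policy, and the penalty terms cost a constant because [th] is bounded. *)
Lemma slack_drift_bound (V theta_max : R) : well_formed M -> exponential_type M ->
  slackness M -> 0 <= V -> 0 <= theta_max ->
  exists (C : R) (H : 'I_L -> borel_rV R q -> R),
  [/\ 0 <= C, (forall l, measurable_fun [set: borel_rV R q] (H l)),
      (forall l w, `|H l w| <= C),
      (forall l, \int[event_law M]_w (H l w)%:E <= 0)%E &
      forall w a (Q : 'I_L -> R) th, event_set M w -> (forall l, 0 <= Q l) ->
        0 <= th <= theta_max ->
        (forall b, objective M V Q th w a <= objective M V Q th w b) ->
        \sum_(l < L) Q l * (zhat M w a ord0 l - budget M l * That M w a) <=
        C + \sum_(l < L) Q l * H l w].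
Proof.
move=> hM hexp [xi [pi [v [xi0 [_ vT vz] hv]]]] V0 th0.
have [C C0 mom] := uniform_moments hexp.
have [cE E1 b0 hmean] := hM.
have [GT [mGT GTC GTE GTv]] : exists G : borel_rV R q -> R,
    [/\ measurable_fun [set: borel_rV R q] G, (forall w, `|G w| <= C),
      (forall w, event_set M w ->
         (pi w).-integrable [set: A] (fun a => (That M w a)%:E) /\
         (\int[pi w]_a (That M w a)%:E = (G w)%:E)%E) &
      (stationary_mean M pi (That M) = \int[event_law M]_w (G w)%:E)%E].
  apply: (@stationary_average _ (@frame_length R L)) => //.
    exact: measurable_frame_length.
  by move=> w a Ew; have [_ mT _ _ _] := mom 0%N w a Ew; have [_ hT _] := hmean 0%N w a Ew.
have /choice[Gz hGz] : forall l, exists G : borel_rV R q -> R,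
    [/\ measurable_fun [set: borel_rV R q] G, (forall w, `|G w| <= C),
      (forall w, event_set M w ->
         (pi w).-integrable [set: A] (fun a => (zhat M w a ord0 l)%:E) /\
         (\int[pi w]_a (zhat M w a ord0 l)%:E = (G w)%:E)%E) &
      (stationary_mean M pi (fun w a => zhat M w a ord0 l) =
       \int[event_law M]_w (G w)%:E)%E].
  move=> l; apply: (@stationary_average _ (fun x => resource x l)) => //.
    exact: measurable_resource.
  move=> w a Ew; have [_ _ _ _ mz] := mom 0%N w a Ew.
  by have [_ _ hz] := hmean 0%N w a Ew.
have intG (G : borel_rV R q -> R) : measurable_fun [set: borel_rV R q] G ->
    (forall w, `|G w| <= C) -> (event_law M).-integrable [set: borel_rV R q] (EFin \o G).
  move=> mG GC; apply: (@integrable_norm_le _ _ _ _ _ C) => //.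
  apply: (@le_trans _ _ (\int[event_law M]_w (cst C%:E w))%E).
    apply: ge0_le_integral => //.
    + by apply/measurable_EFinP; apply: measurableT_comp.
    + by move=> w _; rewrite lee_fin.
  by rewrite (@integral_probability_cst _ _ _ (event_law M)).
(* Slackness speaks of a ratio; its denominator must be positive to yield the sign of the mean
   excess. *)
have vT1 : 1 <= v.1.2.
  rewrite -lee_fin -vT -E1 /stationary_mean.
  rewrite (eq_integral (EFin \o GT)); last first.
    by move=> w /set_mem Ew; have [_ ->] := GTE w Ew.
  rewrite -[leLHS]mul1e -integral_cst; last exact: compact_measurable_rV.
  have GT1 w : event_set M w -> 1 <= GT w.
    move=> Ew; have [iT IT] := GTE w Ew; rewrite -lee_fin -IT.
    rewrite (_ : 1%:E = \int[pi w]_a (cst 1%E a))%E; last first.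
      by rewrite integral_cst// prob_kernel mul1e.
    apply: ge0_le_integral => //.
    + by have /integrableP[] := iT.
    + by move=> a _; rewrite lee_fin mean_frame_length_ge1.
  apply: ge0_le_integral => //.
  - exact: compact_measurable_rV.
  - by apply: measurable_funTS; exact/measurable_EFinP.
pose c := \sum_(l < L) `|budget M l|.
have c0 : 0 <= c by apply: sumr_ge0.
have bc l : budget M l <= c.
  by rewrite /c (bigD1 l)//= -[leLHS]addr0 lerD ?ler_norm ?sumr_ge0.
(* The first summand pays for the penalty terms of two competing actions; the other two bound
   [H]. *)
pose C' := 2 * V * (C + theta_max * C) + C + c * C.
have VC0 : 0 <= V * (C + theta_max * C) by rewrite mulr_ge0// addr_ge0// mulr_ge0.
have cC0 : 0 <= c * C by rewrite mulr_ge0.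
exists C', (fun l w => Gz l w - budget M l * GT w); split.
- by rewrite /C'; lra.
- move=> l; have [mz _ _ _] := hGz l.
  by apply: measurable_funB => //; exact: measurable_funM.
- move=> l w; have [_ zC _ _] := hGz l.
  have h : `|budget M l * GT w| <= c * C.
    by rewrite normrM (ger0_norm (b0 l)) ler_pM.
  by apply: (le_trans (ler_normB _ _)); have := zC w; rewrite /C'; lra.
- move=> l; have [mz zC _ zv] := hGz l.
  have vzl := vz l; rewrite zv in vzl; have vTl := vT; rewrite GTv in vTl.
  have [_ ->] := integral_subZ (budget M l) (intG _ mz zC) (intG _ mGT GTC) vzl vTl.
  have v0 : v.1.2 != 0 by rewrite gt_eqF// (lt_le_trans _ vT1).
  have -> : v.2 ord0 l = (budget M l - xi) * v.1.2 by rewrite -hv divfK.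
  by rewrite lee_fin mulrBl addrAC subrr sub0r oppr_le0 mulr_ge0 ?ltW// (lt_le_trans _ vT1).
- move=> w a Q th Ew Q0 /andP[th1 th2] opt.
  have bnd b : `|yhat M w b| <= C /\ `|That M w b| <= C.
    have [my mT _ _ _] := mom 0%N w b Ew; have [hy hT _] := hmean 0%N w b Ew.
    split; first exact: norm_mean_le (@measurable_penalty R L) my hy.
    exact: norm_mean_le (@measurable_frame_length R L) mT hT.
  pose f l b := zhat M w b ord0 l - budget M l * That M w b.
  have hf l : (pi w).-integrable [set: A] (EFin \o f l) /\
      (\int[pi w]_b (f l b)%:E = (Gz l w - budget M l * GT w)%:E)%E.
    have [_ _ zE _] := hGz l; have [iz Iz] := zE w Ew; have [iT IT] := GTE w Ew.
    exact: integral_subZ iz iT Iz IT.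
  have [iS IS] := integral_lincomb Q (fun l => (hf l).1) (fun l => (hf l).2).
  set K := \sum_(l < L) _.
  (* The left side does not depend on the action drawn from [pi w], so it equals its own mean and
     may be compared with each [b]. *)
  suff h : K - 2 * V * (C + theta_max * C) <=
      \sum_(l < L) Q l * (Gz l w - budget M l * GT w) by rewrite /C'; lra.
  rewrite -lee_fin -IS.
  rewrite (_ : (K - _)%:E =
    \int[pi w]_b (cst (K - 2 * V * (C + theta_max * C))%:E b))%E; last first.
    by rewrite integral_cst// prob_kernel mule1.
  apply: le_integral => //.
    apply: (@integrable_norm_le _ _ _ _ _ `|K - 2 * V * (C + theta_max * C)|) => //.
    by rewrite integral_cst// prob_kernel mule1.
  move=> b _; rewrite lee_fin.
  have := opt b; rewrite /objective -/K.
  have [/ler_normlP[y1 y2] /ler_normlP[T1 T2]] := bnd a.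
  have [/ler_normlP[y3 y4] /ler_normlP[T3 T4]] := bnd b.
  have : th * (That M w a - That M w b) <= theta_max * (2 * C).
    apply: (@le_trans _ _ (th * (2 * C))).
      by rewrite ler_wpM2l//; lra.
    by rewrite ler_wpM2r//; lra.
  rewrite -/(\sum_(l < L) Q l * f l b).
  move: (\sum_(l < L) Q l * f l b) => S2 h1 h2.
  have : V * (yhat M w b - th * That M w b - (yhat M w a - th * That M w a)) <=
      V * (2 * (C + theta_max * C)).
    by rewrite ler_wpM2l//; lra.
  lra.
Qed.

End stationary.

(** * Queues *)

Lemma le_limn_esup (R : realType) (u v : (\bar R)^nat) :
  (forall n, u n <= v n)%E -> (limn_esup u <= limn_esup v)%E.
Proof.
move=> uv; rewrite !limn_esup_lim; apply: lee_lim; [exact: is_cvg_esups..|].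
apply: nearW => n; apply: ge_ereal_sup => _ [k /= nk <-].
by apply: (le_trans (uv k)); apply: ereal_sup_ubound; exists k.
Qed.

Section queues.
Local Set Implicit Arguments.
Local Unset Strict Implicit.
Context (R : realType) (q L : nat) (dA : measure_display) (A : measurableType dA).
Context (dS : measure_display) (S : measurableType dS) (P : probability S R).
Variables (M : renewal_model R q L A) (theta_max V delta : R).
Variables (X : process R q L A S) (Q : nat -> S -> 'I_L -> R) (theta : nat -> S -> R).

(** The generators of [past X n], kept apart so that [g_sigma_algebraType] can turn them into a
    measurable space; [past X n] is [<<s history n >>] by definition. *)
Definition history (n : nat) : set (set S) :=
  \bigcup_(i in [set i | (i < n)%N])
    (preimage_set_system [set: S] (event_of X i) measurable `|`
     preimage_set_system [set: S] (action_of X i) measurable `|`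
     preimage_set_system [set: S] (outcome_of X i) measurable).

Local Notation x n l s := (excess M l (outcome_of X n s)).

(** A statement about one path. Clipping only raises the queue, so it dominates the sum of the
    excesses; the total frame length is at least [N], so dividing by it leaves at most
    [Q N s l / N]. *)
Lemma limn_esup_average_resource l s : 0 <= budget M l ->
  online_algorithm M V delta theta_max X Q theta ->
  (forall n, 1 <= frame_length (outcome_of X n s)) ->
  (fun n => Q n s l / n%:R) @ \oo --> 0 ->
  (limn_esup (fun N => (average_resource X l s N)%:E) <= (budget M l)%:E)%E.
Proof.
move=> b0 /(_ s)[Q0 _ _ _ QS] T1 Qcvg.
have Qge n : 0 <= Q n s l.
  by case: n => [|n]; [rewrite Q0|rewrite QS le_max lexx orbT].
have sumQ N : \sum_(0 <= n < N) x n l s <= Q N s l.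
  elim: N => [|N IH]; first by rewrite big_nil Q0.
  by rewrite big_nat_recr//= QS le_max; apply/orP; left; rewrite /excess; lra.
have sumT N : N%:R <= \sum_(0 <= n < N) frame_length (outcome_of X n s).
  elim: N => [|N IH]; first by rewrite big_nil.
  by rewrite big_nat_recr//= -natr1 lerD.
apply: (@le_trans _ _ (limn_esup (fun N => (budget M l + Q N s l / N%:R)%:E))).
  apply: le_limn_esup => -[|N]; rewrite lee_fin /average_resource.
    (* At [N = 0] both quotients are 0 by the convention on inverses, and the claim is that the
       budget is nonnegative. *)
    by rewrite !big_nil mul0r invr0 mulr0 addr0.
  have N0 : 0 < N.+1%:R :> R by [].
  have T0 := lt_le_trans N0 (sumT N.+1).
  rewrite ler_pdivrMr//.
  have -> : \sum_(0 <= n < N.+1) resource (outcome_of X n s) l =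
      \sum_(0 <= n < N.+1) x n l s +
      budget M l * \sum_(0 <= n < N.+1) frame_length (outcome_of X n s).
    rewrite mulr_sumr -big_split/=; apply: eq_bigr => n _.
    by rewrite /excess subrK.
  rewrite mulrDl addrC lerD2l (le_trans (sumQ _))//.
  by rewrite mulrAC ler_pdivlMr// ler_wpM2l.
have cv : (fun N => (budget M l + Q N s l / N%:R)%:E) @ \oo --> (budget M l)%:E.
  apply: cvg_EFin; first exact: nearW.
  rewrite -[X in _ --> X]addr0; apply: cvgD => //; exact: cvg_cst.
by have [_ ->] := cvg_limn_einf_sup cv.
Qed.

(** * Measurability and conditional laws with respect to the history *)

Hypothesis hX : driven_by M P X.

Lemma measurable_outcome_of n : measurable_fun [set: S] (outcome_of X n).
Proof. by have [_ /(_ n)[]] := hX. Qed.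

Lemma measurable_event_of n : measurable_fun [set: S] (event_of X n).
Proof. by have [_ /(_ n)[]] := hX. Qed.

Lemma measurable_pair_of n :
  measurable_fun [set: S] (fun s => (event_of X n s, action_of X n s)).
Proof.
by have [_ /(_ n)[]] := hX => me ma _ _ _; exact: measurable_fun_pair.
Qed.

Lemma history_measurable n : <<s history n >> `<=` @measurable _ S.
Proof.
apply: smallest_sub; first exact: sigma_algebra_measurable.
move=> B [i _] [[]|] [D mD <-]; have [_ /(_ i)[me ma mo] _ _] := hX.
- exact: me.
- exact: ma.
- exact: mo.
Qed.

Lemma outcome_of_history n i : (i < n)%N ->
  measurable_fun [set: g_sigma_algebraType (history n)] (outcome_of X i).
Proof.
move=> i_n _ D mD; apply: sub_sigma_algebra; exists i => //.
by right; exists D.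
Qed.

Lemma history_outcome_law n H D : <<s history n >> H -> measurable D ->
  P (H `&` outcome_of X n @^-1` D) =
  (\int[P]_(s in H) outcome_law M n (event_of X n s, action_of X n s) D)%E.
Proof.
move=> hH mD; have [_ _ _ /(_ n H setT D hH measurableT mD)] := hX.
by rewrite preimage_setT setIT.
Qed.

(** Independence from the past, written as a conditional law with a constant kernel so that the
    product formula applies to it. *)
Lemma history_event_law n H D : <<s history n >> H -> measurable D ->
  P (H `&` event_of X n @^-1` D) = (\int[P]_(s in H) event_law M D)%E.
Proof.
move=> hH mD; have [_ _ /(_ n H D hH mD) -> _] := hX.
rewrite muleC; symmetry.
exact: (integral_cst P (history_measurable hH) (event_law M D)).
Qed.

Lemma measurable_outcome_law n D : measurable D -> measurable_fun [set: S]
  (fun s => outcome_law M n (event_of X n s, action_of X n s) D).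
Proof.
move=> mD; apply: (measurableT_comp (measurable_kernel (outcome_law M n) D mD)).
exact: measurable_pair_of.
Qed.

Lemma ae_frame_length_ge1 : exponential_type M ->
  {ae P, forall s, forall n, 1 <= frame_length (outcome_of X n s)}.
Proof.
move=> [hT _]; apply: ae_foralln => n.
pose D := [set y : outcome R L | frame_length y < 1].
have mD : measurable D.
  by rewrite -[D]setTI; apply: (measurable_fun_ltr (@measurable_frame_length R L)).
exists (outcome_of X n @^-1` D); split.
- by rewrite -[X in measurable X]setTI; exact: measurable_outcome_of.
- have hS : <<s history n >> setT by exact: (@measurableT _ (g_sigma_algebraType (history n))).
  have := history_outcome_law hS mD; rewrite setTI => PD; apply: (etrans PD).
  apply: integral0_eq => s _; have [hE _ _ _] := hX.
  apply: measure_negligible => //.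
  apply: negligibleS (hT n _ (action_of X n s) (hE n s)) => y.
  by rewrite /D /= => h1 h2; move: h1; rewrite ltNge h2.
- by move=> s /= /negP; rewrite -ltNge.
Qed.

Hypothesis halg : online_algorithm M V delta theta_max X Q theta.

Lemma queue_ge0 n s l : 0 <= Q n s l.
Proof.
have [Q0 _ _ _ QS] := halg s.
by case: n => [|n]; [rewrite Q0|rewrite QS le_max lexx orbT].
Qed.

(** The queue update reads outcomes only, so [Q n] is a function of the frames before [n] and can be
    the factor known from the past. *)
Lemma queue_history n m l : (n <= m)%N ->
  measurable_fun [set: g_sigma_algebraType (history m)] (fun s => Q n s l).
Proof.
elim: n => [|n IH] nm.
  rewrite (_ : (fun s => _) = cst 0); first exact: measurable_cst.
  by apply/funext => s; have [-> _ _ _ _] := halg s.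
rewrite (_ : (fun s => _) = fun s => Num.max (Q n s l + x n l s) 0).
  apply: measurable_maxr => //; apply: measurable_funD; first exact: IH (ltnW nm).
  by apply: measurableT_comp; [exact: measurable_excess|exact: outcome_of_history].
by apply/funext => s; have [_ _ _ _ ->] := halg s; rewrite /excess addrA.
Qed.

Lemma measurable_queue n l : measurable_fun [set: S] (fun s => Q n s l).
Proof.
move=> _ B mB; apply: (@history_measurable n).
exact: (queue_history l (leqnn n) measurableT mB).
Qed.

Lemma measurable_excess_of n l : measurable_fun [set: S] (fun s => x n l s).
Proof.
by apply: measurableT_comp; [exact: measurable_excess|exact: measurable_outcome_of].
Qed.

Lemma theta_bounds n s : 0 <= theta_max -> 0 <= theta n s <= theta_max.
Proof.
move=> th0; have [_ t0 _ tS _] := halg s.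
case: n => [|n]; first by rewrite t0 lexx.
by rewrite tS le_min th0 andbT le_max lexx orbT ge_min lexx orbT.
Qed.

Lemma queueS_le n s l : Q n.+1 s l <= Q n s l + `|x n l s|.
Proof.
have [_ _ _ _ ->] := halg s; rewrite -addrA ge_max lerD2l ler_norm.
by rewrite addr_ge0// queue_ge0.
Qed.

(** Clipping at 0 does not increase a square. *)
Lemma queueS_sqr_le n s l :
  Q n.+1 s l ^+ 2 <= Q n s l ^+ 2 + 2 * (Q n s l * x n l s) + x n l s ^+ 2.
Proof.
have -> : Q n.+1 s l = Num.max (Q n s l + x n l s) 0.
  by have [_ _ _ _ ->] := halg s; rewrite /excess addrA.
case: (leP (Q n s l + x n l s) 0) => _; last by rewrite sqrrD mulr_natl.
rewrite expr0n/=; apply: le_trans (sqr_ge0 (Q n s l + x n l s)) _.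
by rewrite sqrrD mulr_natl.
Qed.

(** * Drift and second moments of the queues *)

Hypothesis hM : well_formed M.
Hypothesis hexp : exponential_type M.

Lemma history_setT n : <<s history n >> setT.
Proof. exact: (@measurableT _ (g_sigma_algebraType (history n))). Qed.

Lemma excess_of_second_moment : exists2 C : R, 0 <= C &
  forall n l, (\int[P]_s (x n l s ^+ 2)%:E <= C%:E)%E.
Proof.
have [C C0 mom] := uniform_moments hexp; exists C => // n l.
have [hE _ _ _] := hX.
have mx2 : measurable_fun [set: outcome R L] (fun y => (excess M l y ^+ 2)%:E).
  by apply/measurable_EFinP; apply: measurable_funX; exact: measurable_excess.
have x20 y : (0 <= (excess M l y ^+ 2)%:E)%E by rewrite lee_fin sqr_ge0.
rewrite (integral_conditional_law (@history_measurable n) (measurable_outcome_of n)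
  (@measurable_outcome_law n) (@history_outcome_law n) (@history_setT n) mx2 x20).
apply: (@le_trans _ _ (\int[P]_s (cst C%:E s))%E).
  apply: ge0_le_integral => //.
  - by move=> s _; exact: integral_ge0.
  - apply: (measurable_integral_law
      (k := fun s => outcome_law M n (event_of X n s, action_of X n s))) => //.
    exact: measurable_outcome_law.
  - by move=> s _; have [_ _ _ + _] := mom n _ (action_of X n s) (hE n s).
by rewrite integral_probability_cst.
Qed.

(** Domination by 1 + Q^2. It turns the induction hypothesis on second moments into the
    integrability that the drift bound asks for. *)
Lemma integrable_queue n l :
  P.-integrable [set: S] (fun s => (Q n s l ^+ 2)%:E) ->
  P.-integrable [set: S] (fun s => (Q n s l)%:E).
Proof.
move=> iQ2.
have i1 : P.-integrable [set: S] (cst 1%E) by exact: finite_measure_integrable_cst.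
apply: le_integrable (integrableD measurableT i1 iQ2) => //.
  by apply/measurable_EFinP; exact: measurable_queue.
move=> s _; rewrite /= lee_fin !ger0_norm ?queue_ge0 ?addr_ge0 ?sqr_ge0//.
by have := sqr_ge0 (Q n s l - 1); rewrite sqrrB1; have := queue_ge0 n s l; lra.
Qed.

Lemma queue_drift_le : slackness M -> 0 < V -> 0 < theta_max ->
  exists2 C : R, 0 <= C & forall n,
    (forall l, P.-integrable [set: S] (fun s => (Q n s l)%:E)) ->
    exists d : 'I_L -> R, [/\ forall l,
        P.-integrable [set: S] (fun s => (Q n s l * x n l s)%:E),
      forall l, (\int[P]_s (Q n s l * x n l s)%:E = (d l)%:E)%E &
      \sum_l d l <= C].
Proof.
move=> hslack V0 th0.
have [C [H [C0 mH HC H0 bound]]] := slack_drift_bound hM hexp hslack (ltW V0) (ltW th0).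
have [C1 C10 mom] := uniform_moments hexp.
have [hE _ _ _] := hX.
exists C => // n iQ.
pose xhat l s := zhat M (event_of X n s) (action_of X n s) ord0 l -
  budget M l * That M (event_of X n s) (action_of X n s).
(* Product formula with the outcome law: the excess is replaced by its mean given the event and the
   action. *)
have hx l : [/\ P.-integrable [set: S] (fun s => (Q n s l * x n l s)%:E),
    P.-integrable [set: S] (fun s => (Q n s l * xhat l s)%:E) &
    (\int[P]_s (Q n s l * x n l s)%:E = \int[P]_s (Q n s l * xhat l s)%:E)%E].
  have xC s : (\int[outcome_law M n (event_of X n s, action_of X n s)]_y
      `|excess M l y|%:E <= C1%:E)%E.
    by have [_ _ + _ _] := mom n _ (action_of X n s) (hE n s).
  have [i1 i2 ->] := integral_conditional_lawM (@history_measurable n)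
    (measurable_outcome_of n) (@measurable_outcome_law n) (@history_outcome_law n)
    (queue_history l (leqnn n)) (fun s => queue_ge0 n s l) (iQ l)
    (measurable_excess M l) xC.
  have xE s : ((Q n s l)%:E *
      \int[outcome_law M n (event_of X n s, action_of X n s)]_y (excess M l y)%:E =
      (Q n s l * xhat l s)%:E)%E.
    by rewrite excess_mean// EFinM.
  split => //; first by apply: eq_integrable i2 => // s _; rewrite xE.
  by apply: eq_integral => s _; rewrite xE.
(* Product formula with the constant kernel: the nonnegative queue multiplies the mean of [H l],
   which is nonpositive. *)
have hH l : P.-integrable [set: S] (fun s => (Q n s l * H l (event_of X n s))%:E) /\
    (\int[P]_s (Q n s l * H l (event_of X n s))%:E <= 0)%E.
  have HC1 (s : S) : (\int[event_law M]_w `|H l w|%:E <= C%:E)%E.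
    apply: (@le_trans _ _ (\int[event_law M]_w (cst C%:E w))%E).
      apply: ge0_le_integral => //.
      + by apply/measurable_EFinP; apply: measurableT_comp => //; exact: mH.
      + by move=> w _; rewrite lee_fin.
    by rewrite (@integral_probability_cst _ _ _ (event_law M)).
  have mc D : measurable D -> measurable_fun [set: S] (fun _ : S => event_law M D).
    by move=> _; exact: measurable_cst.
  have [i1 i2 ->] := integral_conditional_lawM (k := fun _ => event_law M)
    (@history_measurable n) (measurable_event_of n) mc (@history_event_law n)
    (queue_history l (leqnn n)) (fun s => queue_ge0 n s l) (iQ l) (mH l) HC1.
  split=> //; rewrite -oppe_ge0 -integralN/=; last first.
    by apply: integrable_add_def.
  apply: integral_ge0 => s _; rewrite oppe_ge0.
  by apply: mule_ge0_le0 => //; rewrite lee_fin queue_ge0.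
pose d l := fine (\int[P]_s (Q n s l * xhat l s)%:E)%E.
pose e l := fine (\int[P]_s (Q n s l * H l (event_of X n s))%:E)%E.
have dE l : (\int[P]_s (Q n s l * xhat l s)%:E = (d l)%:E)%E.
  by have [_ i2 _] := hx l; rewrite fineK// integrable_fin_num.
have eE l : (\int[P]_s (Q n s l * H l (event_of X n s))%:E = (e l)%:E)%E.
  by have [i1 _] := hH l; rewrite fineK// integrable_fin_num.
exists d; split=> [l|l|].
- by have [] := hx l.
- by have [_ _ ->] := hx l.
have ix l : P.-integrable [set: S] (fun s => (Q n s l * xhat l s)%:E).
  by have [] := hx l.
have [ixs Ixs] := integral_lincomb (fun=> 1) ix dE.
have [iHs IHs] := integral_lincomb (fun=> 1) (fun l => (hH l).1) eE.
have iC : P.-integrable [set: S] (fun=> C%:E) by exact: finite_measure_integrable_cst.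
have IC : (\int[P]_s C%:E = C%:E)%E.
  by rewrite integral_probability_cst.
have [iCH ICH] := integral_subZ (-1) iC iHs IC IHs.
have : (\sum_l d l)%:E = (\sum_i 1 * d i)%:E.
  by congr EFin; apply: eq_bigr => l _; rewrite mul1r.
rewrite -lee_fin => ->; rewrite -Ixs.
apply: (@le_trans _ _ (\int[P]_s (C - -1 * \sum_i 1 * (Q n s i * H i (event_of X n s)))%:E)%E).
  apply: le_integral => // s _; rewrite lee_fin mulN1r opprK.
  under eq_bigr do rewrite mul1r.
  under [X in _ <= _ + X]eq_bigr do rewrite mul1r.
  have [_ _ opt _ _] := halg s.
  by apply: (bound _ _ (Q n s) (theta n s)) => //; [move=> l; exact: queue_ge0|
    exact/theta_bounds/ltW].
rewrite ICH lee_fin mulN1r opprK gerDl; apply: sumr_le0 => l _; rewrite mul1r.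
by rewrite -lee_fin -eE; have [] := hH l.
Qed.

Lemma queue_second_moment : slackness M -> 0 < V -> 0 < theta_max ->
  exists2 K : R, 0 <= K &
    forall n l, (\int[P]_s (Q n s l ^+ 2)%:E <= (K * n%:R)%:E)%E.
Proof.
move=> hslack V0 th0.
have [C C0 drift] := queue_drift_le hslack V0 th0.
have [D D0 hD] := excess_of_second_moment.
(* Growth per frame: [2 * C] from the cross terms, and [D] for each of the [L] squared
   increments. *)
have K0 : 0 <= 2 * C + L%:R * D by rewrite addr_ge0 ?mulr_ge0.
have ix n l : P.-integrable [set: S] (fun s => (x n l s ^+ 2)%:E).
  apply: (@integrable_norm_le _ _ _ _ (fun s => x n l s ^+ 2) D).
    by apply: measurable_funX; exact: measurable_excess_of.
  by under eq_integral do rewrite ger0_norm ?sqr_ge0//.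
have mQ2 n l : measurable_fun [set: S] (fun s => (Q n s l ^+ 2)%:E).
  by apply/measurable_EFinP; apply: measurable_funX; exact: measurable_queue.
(* The drift is controlled only summed over [l], so the induction bounds the total second moment; a
   single queue follows at the end, the other terms being nonnegative. *)
have key n : exists2 m : 'I_L -> R,
    (forall l, P.-integrable [set: S] (fun s => (Q n s l ^+ 2)%:E) /\
       (\int[P]_s (Q n s l ^+ 2)%:E = (m l)%:E)%E) &
    \sum_l m l <= (2 * C + L%:R * D) * n%:R.
  elim: n => [|n [m hm mK]].
    exists (fun=> 0); last by rewrite big1_eq mulr0.
    move=> l; have E s : (Q 0%N s l ^+ 2)%:E = 0%E.
      by have [-> _ _ _ _] := halg s; rewrite expr0n.
    split; last by apply: integral0_eq => s _; rewrite E.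
    by apply: eq_integrable (integrable0 P [set: S]) => // s _; rewrite E.
  have [d [id Id dC]] := drift n (fun l => integrable_queue (hm l).1).
  pose e l := fine (\int[P]_s (x n l s ^+ 2)%:E)%E.
  have eE l : (\int[P]_s (x n l s ^+ 2)%:E = (e l)%:E)%E.
    by rewrite fineK// integrable_fin_num.
  have eD l : e l <= D by rewrite -lee_fin -eE.
  have bnd l : P.-integrable [set: S]
        (fun s => (Q n s l ^+ 2 - -2 * (Q n s l * x n l s) - -1 * x n l s ^+ 2)%:E) /\
      (\int[P]_s (Q n s l ^+ 2 - -2 * (Q n s l * x n l s) - -1 * x n l s ^+ 2)%:E =
       (m l - -2 * d l - -1 * e l)%:E)%E.
    have [i1 I1] := integral_subZ (-2) (hm l).1 (id l) (hm l).2 (Id l).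
    exact: (integral_subZ (-1) i1 (ix n l) I1 (eE l)).
  have Qbnd s l : (Q n.+1 s l ^+ 2 <=
      Q n s l ^+ 2 - -2 * (Q n s l * x n l s) - -1 * x n l s ^+ 2).
    by have := queueS_sqr_le n s l; lra.
  have iQ l : P.-integrable [set: S] (fun s => (Q n.+1 s l ^+ 2)%:E).
    apply: le_integrable (bnd l).1 => // s _.
    by rewrite /= lee_fin ger0_norm ?sqr_ge0// (le_trans (Qbnd s l))// ler_norm.
  pose m' l := fine (\int[P]_s (Q n.+1 s l ^+ 2)%:E)%E.
  have mE l : (\int[P]_s (Q n.+1 s l ^+ 2)%:E = (m' l)%:E)%E.
    by rewrite fineK// integrable_fin_num.
  exists m' => //.
  have m'le l : m' l <= m l + 2 * d l + D.
    apply: (@le_trans _ _ (m l - -2 * d l - -1 * e l)); last by have := eD l; lra.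
    rewrite -lee_fin -mE -(bnd l).2; apply: le_integral => //; first exact: (bnd l).1.
    by move=> s _; rewrite lee_fin.
  apply: (le_trans (ler_sum _ (fun l _ => m'le l))).
  rewrite !big_split/= -mulr_sumr sumr_const card_ord -mulr_natl -natr1; lra.
exists (2 * C + L%:R * D) => // n l.
have [m hm mK] := key n; have [_ ->] := hm l; rewrite lee_fin; apply: le_trans mK.
rewrite (bigD1 l)//= lerDl sumr_ge0// => j _; rewrite -lee_fin; have [_ <-] := hm j.
by apply: integral_ge0 => s _; rewrite lee_fin sqr_ge0.
Qed.

End queues.

Theorem theorem5p4p1 (R : realType) (q L : nat)
    (dA : measure_display) (A : measurableType dA)
    (M : renewal_model R q L A) (theta_max V delta : R)
    (dS : measure_display) (S : measurableType dS) (P : probability S R)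
    (X : process R q L A S)
    (Q : nat -> S -> 'I_L -> R) (theta : nat -> S -> R)
    (hM : well_formed M)
    (hexp : exponential_type M)
    (htheta_max : 0 < theta_max)
    (hopt : (0 <= optimal_value M < theta_max%:E)%E)
    (hcompact : compact_options M)
    (hbounded : bounded_set (stationary_region M))
    (hslack : slackness M)
    (hV : 0 < V)
    (hdelta : 0 < delta)
    (hX : driven_by M P X)
    (halg : online_algorithm M V delta theta_max X Q theta) :
  {ae P, forall s, forall l : 'I_L,
     (limn_esup (fun N : nat =>
        ((\sum_(0 <= n < N) resource (outcome_of X n s) l) /
         (\sum_(0 <= n < N) frame_length (outcome_of X n s)))%:E)
      <= (budget M l)%:E)%E}.

Proof.
have [K K0 hK] := queue_second_moment hX halg hM hexp hslack hV htheta_max.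
have [D D0 hD] := excess_of_second_moment hX hexp.
have Qcvg : {ae P, forall s, forall l, (fun n => Q n s l / n%:R) @ \oo --> 0}.
  have : forall l, {ae P, forall s, (fun n => Q n s l / n%:R) @ \oo --> 0}.
    move=> l.
    (* One constant has to serve both for the queue and for its increments, hence [K + D]. *)
    apply: (@ae_cvg0_div _ _ _ P (fun n s => Q n s l)
      (fun n s => excess M l (outcome_of X n s)) (K + D)).
    - by move=> n; exact: measurable_queue hX halg n l.
    - by move=> n; exact: measurable_excess_of hX n l.
    - by move=> n s; exact: queue_ge0 halg n s l.
    - by move=> n s; exact: queueS_le halg n s l.
    - move=> n; apply: (le_trans (hK n l)); rewrite lee_fin.
      by rewrite ler_wpM2r// lerDl.
    - by move=> n; apply: (le_trans (hD n l)); rewrite lee_fin lerDr.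
  exact: filter_forall.
have T1 := ae_frame_length_ge1 hX hexp.
move: Qcvg T1; apply: filterS2 => s Qs Ts l.
have [_ _ b0 _] := hM.
by apply: (limn_esup_average_resource (theta_max := theta_max) (V := V)
  (delta := delta) (Q := Q) (theta := theta)).
Qed.
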